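(* Let $d\ge3$ and $1\le k\le d$ be integers. Let $(g_n)$ be a sequence of ball-like subsets of the torus $\mathbb T^d$ with diameters $\rho_n$, let $(\xi_n)$ be a sequence of independent random variables uniformly distributed on $\mathbb T^d$, and let $$E=\limsup_{n\to\infty}(\xi_n+g_n)=\bigcap_{m=1}^\infty\bigcup_{n=m}^\infty(\xi_n+g_n)\subset\mathbb T^d$$ be the associated ball-like random covering set, with almost sure Hausdorff dimension $s_0$. Suppose that $s_0<k$. Then, almost surely, for all $k$-dimensional linear subspaces $V\subset\mathbb R^d$, $\dim_H\pi_V(E)=s_0$.
   Context: A sequence $(g_n)$ of subsets of $\mathbb T^d$ is called ball-like if, with $\rho_n$ denoting the diameter of $g_n$, the sequence $(\rho_n)$ decreases to zero and there are balls $B(x_n,\delta_n)\subset g_n$ such that $$\lim_{n\to\infty}\frac{\log\rho_n}{\log\delta_n}=1 .$$ (This is implied by $\limsup_{n\to\infty}\rho_n/\delta_n<+\infty$.) The almost sure Hausdorff dimension of $E$ is given by $$s_0=\inf\Big\{s\ge0:\sum_{n=1}^\infty\rho_n^s<\infty\Big\}=\limsup_{n\to\infty}\frac{\log n}{-\log\rho_n}$$ when this quantity is at most $d$. The translates $\xi_n+g_n$ are taken in $\mathbb T^d$. For projections, $\mathbb T^d$ is embedded in $\mathbb R^d$ in the natural way, as the unit cube. $\pi_V$ denotes the orthogonal projection onto $V$, and $\dim_H$ is Hausdorff dimension. *)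

(* Defs.v *)
From HB Require Import structures.
From mathcomp Require Import all_boot all_order all_algebra.
From mathcomp Require Import all_classical all_reals all_analysis.

Set Implicit Arguments.
Unset Strict Implicit.
Unset Printing Implicit Defensive.

Import Order.TTheory GRing.Theory Num.Theory.
Import numFieldTopology.Exports numFieldNormedType.Exports.

Local Open Scope classical_set_scope.
Local Open Scope ring_scope.

Section metric.
Context (R : realType) (T : Type) (dist : T -> T -> R).
Local Open Scope ereal_scope.

(* The diameter is extended-real valued because [sup] is 0 on unbounded sets
   of reals. For A = set0 the value is -oo; [hausdorff_term] treats set0
   apart. *)
Definition diam (A : set T) : \bar R :=
  ereal_sup [set (dist p.1 p.2)%:E | p in A `*` A].

Definition hausdorff_term (s : R) (U : set T) : \bar R :=
  if U == set0 then 0 else poweR (diam U) s.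

Definition hausdorff_premeasure (s delta : R) (A : set T) : \bar R :=
  ereal_inf [set \sum_(0 <= i <oo) hausdorff_term s (U i) |
    U in [set U : (set T)^nat |
      A `<=` \bigcup_i U i /\ forall i, diam (U i) <= delta%:E]].

Definition hausdorff_measure (s : R) (A : set T) : \bar R :=
  ereal_sup [set hausdorff_premeasure s delta A |
    delta in [set delta : R | (0 < delta)%R]].

Definition hausdorff_dim (A : set T) : \bar R :=
  ereal_inf [set s%:E | s in
    [set s : R | (0 <= s)%R /\ hausdorff_measure s A = 0]].

End metric.

Section euclidean.
Context (R : realType) (d : nat).
Implicit Types x y : 'rV[R]_d.

Definition dotp x y : R := \sum_i x 0 i * y 0 i.

(* The norm that the library puts on matrices is the sup norm, hence an
   explicit Euclidean one. *)
Definition eucl_norm x : R := Num.sqrt (dotp x x).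

Definition eucl_dist x y : R := eucl_norm (x - y).

(* A linear subspace is the row space of a matrix V, and [kermx V^T] is its
   orthogonal complement (the u such that u *m V^T = 0), so that this is the
   projection onto V along its orthogonal complement; see [orth_projP]. *)
Definition orth_proj (V : 'M[R]_d) x : 'rV[R]_d :=
  x *m proj_mx V (kermx V^T).

Lemma dotpE x y : dotp x y = (x *m y^T) 0 0.
Proof. by rewrite /dotp mxE; apply: eq_bigr => i _; rewrite mxE. Qed.

Lemma dotp_eq0 x : dotp x x = 0 -> x = 0.
Proof.
move=> /eqP; rewrite /dotp psumr_eq0; last by move=> i _; rewrite -expr2 sqr_ge0.
move=> /allP x0; apply/rowP => i; rewrite mxE.
by have /eqP := x0 i (mem_index_enum i); rewrite -expr2 => /eqP;
  rewrite sqrf_eq0 => /eqP.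
Qed.

Lemma cap_orthomx (V : 'M[R]_d) : (V :&: kermx V^T)%MS = 0.
Proof.
apply/eqP; rewrite -submx0; apply/row_subP => i.
set u := row i _.
have : (u <= V :&: kermx V^T)%MS by exact: row_sub.
rewrite sub_capmx => /andP[/submxP[a ua] /sub_kermxP uV].
suff -> : u = 0 by exact: sub0mx.
apply: dotp_eq0; rewrite dotpE [X in X^T]ua trmx_mul mulmxA uV mul0mx.
by rewrite mxE.
Qed.

Lemma orth_projP (V : 'M[R]_d) x :
  (orth_proj V x <= V)%MS /\
  forall v : 'rV[R]_d, (v <= V)%MS -> dotp (x - orth_proj V x) v = 0.
Proof.
split; first exact: proj_mx_sub.
move=> v /submxP[a ->].
have full : (x <= V + kermx V^T)%MS.
  apply: submx_full; rewrite /row_full.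
  have := mxrank_sum_cap V (kermx V^T).
  rewrite cap_orthomx mxrank0 addn0 => ->.
  by rewrite mxrank_ker mxrank_tr subnKC// rank_leq_col.
have /sub_kermxP xV : (x - orth_proj V x <= kermx V^T)%MS.
  by apply: proj_mx_compl_sub.
by rewrite dotpE trmx_mul mulmxA xV mul0mx mxE.
Qed.

(* Points of the torus R^d/Z^d are their representatives in the unit cube;
   [torus] is therefore also the image of the natural embedding in R^d. *)
Definition torus : set 'rV[R]_d := [set x | forall i, 0 <= x 0 i < 1].

Definition torus_repr x : 'rV[R]_d :=
  \row_i (x 0 i - (Num.floor (x 0 i))%:~R).

Definition torus_dist x y : R :=
  inf [set eucl_norm (x - y + map_mx intr z) | z in [set: 'rV[int]_d]].

Definition torus_ball x (r : R) : set 'rV[R]_d :=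
  [set y | torus y /\ torus_dist x y < r].

Definition translate x (A : set 'rV[R]_d) : set 'rV[R]_d :=
  [set torus_repr (x + y) | y in A].

Definition torus_diam (A : set 'rV[R]_d) : R := fine (diam torus_dist A).

Definition ball_like (g : (set 'rV[R]_d)^nat) : Prop :=
  [/\ forall n, g n `<=` torus,
      nonincreasing_seq (fun n => torus_diam (g n)),
      (fun n => torus_diam (g n)) @ \oo --> (0 : R) &
      exists (x : nat -> 'rV[R]_d) (delta : nat -> R),
        (forall n, [/\ torus (x n), 0 < delta n &
                       torus_ball (x n) (delta n) `<=` g n]) /\
        (fun n => ln (torus_diam (g n)) / ln (delta n)) @ \oo --> (1 : R)].

(* The infimum is +oo if no such s exists. *)
Definition covering_dim (g : (set 'rV[R]_d)^nat) : \bar R :=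
  ereal_inf [set s%:E | s in [set s : R | 0 <= s /\
    (\sum_(0 <= n <oo) (torus_diam (g n) `^ s)%:E < +oo)%E]].

Definition covering_set (xi : nat -> 'rV[R]_d) (g : (set 'rV[R]_d)^nat) :
    set 'rV[R]_d :=
  lim_sup_set (fun n => translate (xi n) (g n)).

End euclidean.

Arguments torus : clear implicits.

(* R^d with its Borel sigma-algebra *)
Notation borel_rV R d := (g_sigma_algebraType (@open 'rV[R]_d)).

Section probability.
Context (disp : measure_display) (Omega : measurableType disp) (R : realType).
Context (P : probability Omega R).

Definition mutually_independent (disp' : measure_display)
    (T : measurableType disp') (X : nat -> {RV P >-> T}) : Prop :=
  forall (J : seq nat) (B : nat -> set T), uniq J ->
    (forall n, measurable (B n)) ->
    P (\bigcap_(n in [set` J]) (X n @^-1` B n)) =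
    (\prod_(n <- J) P (X n @^-1` B n))%E.

(* The law of X is the normalized Lebesgue measure of the torus, i.e. the
   Borel measure on the unit cube that gives every box its volume. *)
Definition uniform_on_torus (d : nat) (X : {RV P >-> borel_rV R d}) : Prop :=
  (forall w, torus R d (X w)) /\
  forall a b : 'rV[R]_d,
    (forall i, 0 <= a 0 i /\ a 0 i <= b 0 i /\ b 0 i <= 1) ->
    distribution P X [set x : 'rV[R]_d | forall i, a 0 i <= x 0 i < b 0 i] =
    (\prod_i (b 0 i - a 0 i))%:E.

End probability.

(* Main.v *)
Require Import Defs.
From mathcomp Require Import all_boot all_order all_algebra.
From mathcomp Require Import all_classical all_reals all_analysis.
From mathcomp Require Import ring lra zify.

Import Order.TTheory GRing.Theory Num.Theory.
Import numFieldTopology.Exports numFieldNormedType.Exports.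

Local Open Scope classical_set_scope.
Local Open Scope ring_scope.

(* The upper bound holds for every realization: cut each [xi_n + g_n] along the
   half-cubes, so that a piece has Euclidean diameter at most [rho_n], and use
   that projections are 1-Lipschitz.

   For the lower bound let [t < s < s0]. As [sum rho_n ^ s'] diverges for some
   [s' > s], there are arbitrarily small scales [1/Q] and arbitrarily late blocks
   of at least [Q ^ s] consecutive indices whose sets all contain a ball of radius
   [1/Q]. The centers of these balls are independent and uniform, so by Chernoff
   bounds, and since only polynomially many tubes have to be considered at each
   scale, with high probability every cell of a fixed grid receives its share of
   the centers, and every tube of width [1/q1] over any [k]-plane contains at most
   a constant times the expected number of them, up to [Q ^ eps]. Almost surely
   such blocks exist after every scale and every index.

   Suppose that sets [U_i] of diameter at most [u_i], with [sum u_i ^ t] small,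
   cover the projection of [E]. The tubes over the [U_i] meeting a cell [B] of
   side [1/q] are given the cost [sum u_i ^ t]. If it is below [c / q ^ t] then
   averaging over the centers of the next good block in [B] yields a much smaller
   cell around one of them with the same property. The nested cells shrink to a
   point of [E] that lies in none of the tubes, a contradiction. *)

(** * Orthogonal projections *)

Section euclidean_facts.
Context (R : realType) (d : nat).
Implicit Types (x y v : 'rV[R]_d) (V : 'M[R]_d).

Lemma dotpC x y : dotp x y = dotp y x.
Proof. by apply: eq_bigr => i _; rewrite mulrC. Qed.

Lemma dotpDl x y v : dotp (x + y) v = dotp x v + dotp y v.
Proof. by rewrite -big_split; apply: eq_bigr => i _; rewrite mxE mulrDl. Qed.

Lemma dotpDr x y v : dotp v (x + y) = dotp v x + dotp v y.
Proof. by rewrite !(dotpC v) dotpDl. Qed.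

Lemma dotp_ge0 x : 0 <= dotp x x.
Proof. by apply: sumr_ge0 => i _; rewrite -expr2 sqr_ge0. Qed.

Lemma eucl_norm_ge0 x : 0 <= eucl_norm x.
Proof. exact: sqrtr_ge0. Qed.

Lemma coord_le_eucl_norm x i : `|x 0 i| <= eucl_norm x.
Proof.
rewrite -[leLHS]sqrtr_sqr ler_sqrt ?dotp_ge0//.
rewrite /dotp (bigD1 i)//= -expr2 lerDl.
by apply: sumr_ge0 => j _; rewrite -expr2 sqr_ge0.
Qed.

Lemma eucl_norm_le_coord x y :
  (forall i, `|x 0 i| <= `|y 0 i|) -> eucl_norm x <= eucl_norm y.
Proof.
move=> xy; rewrite ler_sqrt ?dotp_ge0//; apply: ler_sum => i _.
by rewrite -!expr2 -(real_normK (num_real (x 0 i)))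
  -(real_normK (num_real (y 0 i))) lerXn2r ?nnegrE.
Qed.

(** The crude factor [d] in place of its square root avoids radicals in all later constants. *)
Lemma eucl_norm_le_sup x m : 0 <= m ->
  (forall i, `|x 0 i| <= m) -> eucl_norm x <= d%:R * m.
Proof.
move=> m0 xm; rewrite -[leRHS]ger0_norm ?mulr_ge0// -sqrtr_sqr.
rewrite ler_sqrt ?sqr_ge0// /dotp (@le_trans _ _ (\sum_(i < d) m ^+ 2))//.
  apply: ler_sum => i _; rewrite -expr2 -(real_normK (num_real (x 0 i))).
  by rewrite lerXn2r ?nnegrE.
rewrite sumr_const card_ord -[leLHS]mulr_natl exprMn ler_wpM2r ?sqr_ge0//.
by rewrite -natrX ler_nat; case: (d) => // n; rewrite leq_pmulr.
Qed.

Lemma norm_dotp_le x y m : (forall i, `|x 0 i| <= 1) ->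
  (forall i, `|y 0 i| <= m) -> `|dotp x y| <= d%:R * m.
Proof.
move=> x1 ym; rewrite (le_trans (ler_norm_sum _ _ _))//.
rewrite (@le_trans _ _ (\sum_(i < d) m))//.
  apply: ler_sum => i _; rewrite normrM (le_trans _ (ym i))//.
  by rewrite ler_piMl.
by rewrite sumr_const card_ord mulr_natl.
Qed.

Lemma orth_projB V x y : orth_proj V (x - y) = orth_proj V x - orth_proj V y.
Proof. by rewrite /orth_proj mulmxBl. Qed.

(** Pythagoras: [x - p] is orthogonal to [p], so its square is what is lost. *)
Lemma eucl_norm_orth_proj V x : eucl_norm (orth_proj V x) <= eucl_norm x.
Proof.
rewrite ler_sqrt ?dotp_ge0//; have [pV pO] := orth_projP V x.
set p := orth_proj V x in pV pO *.
have -> : dotp x x = dotp p p + dotp (x - p) (x - p).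
  have dxp : dotp x p = dotp p p.
    by rewrite -{1}(subrK p x) dotpDl (pO _ pV) add0r.
  have dD u : dotp (x - p) u = dotp x u - dotp p u.
    have := dotpDl (x - p) p u; rewrite subrK => ->; first by rewrite addrK.
  by rewrite dD [dotp x (x - p)]dotpC [dotp p (x - p)]dotpC !dD dxp subrr subr0
    [dotp p x]dotpC dxp addrC subrK.
by rewrite lerDl dotp_ge0.
Qed.

Lemma dotp_orth_proj V v x : (v <= V)%MS -> dotp v x = dotp v (orth_proj V x).
Proof.
move=> vV; have [_ /(_ _ vV) h] := orth_projP V x.
by rewrite dotpC -(subrK (orth_proj V x) x) dotpDl h add0r subrK dotpC.
Qed.

End euclidean_facts.

(* Maximizing a minor of a basis of V, Cramer's rule bounds the entries of the
   basis that is the identity on the corresponding columns. *)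
Lemma rank_pivots (R : realFieldType) d k (V : 'M[R]_d) : \rank V = k ->
  exists (f : 'I_k -> 'I_d) (W : 'M[R]_(k, d)),
    [/\ injective f, (W <= V)%MS,
        forall a b, W a (f b) = (a == b)%:R & forall a c, `|W a c| <= 1].
Proof.
move=> <-; set B := row_base V.
pose F (f : {ffun 'I_(\rank V) -> 'I_d}) := `|\det (colsub f B)|.
have [f0 f0P] : exists f, F f > 0.
  have Bfull : row_full B^T by rewrite /row_full mxrank_tr -[_ == _]/(row_free B) row_base_free.
  exists [ffun i => fullrankfun Bfull i].
  rewrite /F normr_gt0 -unitfE -unitmxE -unitmx_tr trmx_mxsub.
  rewrite (_ : mxsub _ _ _ = rowsub (fullrankfun Bfull) B^T).
    by rewrite -row_full_unit; apply: fullrowsub_full.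
  by apply/matrixP => i j; rewrite !mxE ffunE.
have [f _ fmax] := @arg_maxP _ _ _ f0 predT F isT.
have Ff : 0 < F f by exact: lt_le_trans f0P (fmax _ isT).
have Bu : colsub f B \in unitmx by rewrite unitmxE unitfE -normr_gt0.
set W := invmx (colsub f B) *m B.
have colW (h : 'I_(\rank V) -> 'I_d) : colsub h W = invmx (colsub f B) *m colsub h B.
  by rewrite mulmx_colsub.
have Wf a b : W a (f b) = (a == b)%:R.
  by have := colW f; rewrite mulVmx// => /matrixP/(_ a b); rewrite !mxE.
have WV : (W <= V)%MS by rewrite mulmx_sub// eq_row_base.
clearbody W; exists f, W; split => //.
- move=> a b fab; apply/eqP; have := Wf a b; rewrite -fab Wf eqxx.
  by case: eqP => // _ /eqP; rewrite oner_eq0.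
(* Replacing pivot column [f a] by column [c] gives a minor of [W] equal to [W a c]. It is a
   quotient of two minors of [B], whose denominator is the maximal one. *)
- move=> a c; pose h := [ffun b => if b == a then c else f b].
  have -> : W a c = \det (colsub h W).
    rewrite (expand_det_row _ a) (bigD1 a)//= big1 ?addr0 => [|j ja]; last first.
      by rewrite !mxE ffunE (negPf ja) Wf eq_sym (negPf ja) mul0r.
    rewrite !mxE ffunE eqxx /cofactor.
    have -> : row' a (col' a (colsub h W)) = 1%:M.
      apply/matrixP => i j; rewrite !mxE ffunE eq_sym (negPf (neq_lift _ _)) Wf.
      by rewrite (inj_eq lift_inj).
    by rewrite det1 mulr1 exprD -expr2 sqrr_sign mulr1.
  rewrite colW det_mulmx det_inv normrM normfV mulrC ler_pdivrMr// mul1r.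
  exact: fmax.
Qed.

(** * Chernoff bounds *)

Section chernoff.
Context (R : realType) (T : finType) (N : nat) (A : {set T}).
Implicit Types f : {ffun 'I_N -> T}.

(** A function [f] is an outcome of [N] independent uniform draws from [T]; probabilities are
    handled as numbers of outcomes. *)
Definition hits f : nat := #|[pred j | f j \in A]|.

(** The summand is a product over the draws, so the sum over all outcomes factorizes. *)
Lemma exp_moment (a : R) :
  \sum_(f : {ffun 'I_N -> T}) a ^+ hits f = (a * #|A|%:R + (#|T|%:R - #|A|%:R)) ^+ N.
Proof.
transitivity (\sum_(f : {ffun 'I_N -> T}) \prod_(j < N) (if f j \in A then a else 1)).
  apply: eq_bigr => f _; rewrite -big_mkcond/= prodr_const.
  by congr (_ ^+ _); apply: eq_card.
rewrite -(bigA_distr_bigA (fun j (z : T) => if z \in A then a else 1))/=.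
rewrite prodr_const card_ord; congr (_ ^+ _).
rewrite (bigID (mem A))/=; congr (_ + _).
  rewrite (eq_bigr (fun=> a)) => [|i ->//].
  by rewrite sumr_const mulr_natr.
rewrite (eq_bigr (fun=> 1)) => [|i /negPf ->//].
by rewrite sumr_const -(cardC (mem A)) natrD addrC addKr.
Qed.

(** Markov's inequality for [expR (b * hits f - t)], which is at least 1 on the counted outcomes. *)
Lemma exp_markov (b t : R) :
  #|[pred f : {ffun 'I_N -> T} | 0 <= b * (hits f)%:R - t]|%:R <=
  expR (- t) * (expR b * #|A|%:R + (#|T|%:R - #|A|%:R)) ^+ N.
Proof.
rewrite -exp_moment mulr_sumr -sum1_card natr_sum big_mkcond/= ler_sum// => f _.
rewrite inE -expRM_natr -expRD [- t + _]addrC; case: ifP => [h|_]; last exact: expR_ge0.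
by rewrite -[leLHS]expR0 ler_expR.
Qed.

Hypothesis T0 : (0 < #|T|)%N.
Let p : R := #|A|%:R / #|T|%:R.

Let TR0 : 0 < #|T|%:R :> R. Proof. by rewrite ltr0n. Qed.

Let moment_le (a : R) : 0 <= a ->
  (a * #|A|%:R + (#|T|%:R - #|A|%:R)) ^+ N <=
  #|T|%:R ^+ N * expR ((a - 1) * (p * N%:R)).
Proof.
move=> a0; have -> : a * #|A|%:R + (#|T|%:R - #|A|%:R) = #|T|%:R * (1 + (a - 1) * p).
  by rewrite /p; field; rewrite gt_eqF.
rewrite exprMn ler_pM2l ?exprn_gt0// mulrA expRM_natr lerXn2r ?nnegrE ?expR_ge0 ?expR_ge1Dx//.
have p0 : 0 <= p by rewrite divr_ge0.
have p1 : p <= 1 by rewrite ler_pdivrMr// mul1r ler_nat max_card.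
nra.
Qed.

(** From [1 - x <= expR (- x)] at one half, the square root of [expR 1] is at most 2. *)
Lemma expR1_le4 : expR 1 <= 4 :> R.
Proof.
have h : 2^-1 <= expR (- 2^-1) :> R.
  by apply: le_trans (expR_ge1Dx _); lra.
have := expR_gt0 (2^-1 : R); move: h; rewrite expRN lef_pV2 ?posrE ?expR_gt0// => h ?.
rewrite [X in expR X](_ : 1 = 2^-1 + 2^-1 :> R); last by lra.
rewrite expRD (_ : 4 = 2 * 2 :> R); last by lra.
by rewrite ler_pM ?expR_ge0.
Qed.

(** Exponent [b = 1]: the factor 3 in front of the mean absorbs [expR 1 - 1], which leaves
    [expR (- M)] from the excess. *)
Lemma chernoff_upper (M : R) :
  #|[pred f : {ffun 'I_N -> T} | 3 * (p * N%:R) + M <= (hits f)%:R]|%:R <= #|T|%:R ^+ N * expR (- M).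
Proof.
apply: le_trans (le_trans _ (exp_markov 1 (3 * (p * N%:R) + M))) _.
  rewrite ler_nat; apply/subset_leq_card/fintype.subsetP => f.
  by rewrite !inE mul1r subr_ge0.
rewrite (le_trans (ler_wpM2l (expR_ge0 _) (moment_le _ (expR_ge0 _))))//.
rewrite mulrCA ler_pM2l ?exprn_gt0// -expRD ler_expR.
have pN : 0 <= p * N%:R by rewrite mulr_ge0// divr_ge0.
have := expR1_le4; nra.
Qed.

(** Exponent [b = -1]: as [expR (-1)] is at most one half, half of the mean is gained in the
    exponent and a quarter is spent on the threshold. *)
Lemma chernoff_lower :
  #|[pred f : {ffun 'I_N -> T} | (hits f)%:R <= p * N%:R / 4]|%:R <=
  #|T|%:R ^+ N * expR (- (p * N%:R / 4)).
Proof.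
apply: le_trans (le_trans _ (exp_markov (-1) (- (p * N%:R / 4)))) _.
  rewrite ler_nat; apply/subset_leq_card/fintype.subsetP => f.
  by rewrite !inE mulN1r opprK addrC subr_ge0.
rewrite (le_trans (ler_wpM2l (expR_ge0 _) (moment_le _ (expR_ge0 _))))//.
rewrite mulrCA ler_pM2l ?exprn_gt0// -expRD ler_expR opprK.
have pN : 0 <= p * N%:R by rewrite mulr_ge0// divr_ge0.
have : expR (-1) <= 2^-1 :> R.
  rewrite expRN lef_pV2 ?posrE ?expR_gt0// (le_trans _ (expR_ge1Dx _))//; lra.
nra.
Qed.

End chernoff.

(** * Grid cells meeting a tube *)

Section tube_cells.
Context (d r m C : nat).
Let cellT := {ffun 'I_d -> 'I_r.+1}.
Context (I : {set 'I_d}) (ell : {ffun 'I_d * 'I_d -> 'I_(2 * r.+1).+1}).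
Context (z0 : cellT).

(** A plane is described by pivot coordinates [I] and by slopes in [[-1, 1]]. The slopes are rounded
    to multiples of [1 / r.+1] and stored in [ell], shifted by [r.+1] to be natural numbers. This
    leaves finitely many tubes for all planes. *)
Definition slope_sum (i : 'I_d) (z : cellT) : int :=
  \sum_(c | c \notin I) ((ell (i, c))%:Z - r.+1%:Z) * ((z c)%:Z - (z0 c)%:Z).

Definition tube_cells : {set cellT} :=
  [set z : cellT | [forall i, if i \in I
    then `|r.+1%:Z * ((z i)%:Z - (z0 i)%:Z) + slope_sum i z| <= C%:Z * r.+1%:Z
    else `|(z i)%:Z - (z0 i)%:Z| <= m%:Z]]%SET.

Lemma card_tube_cells :
  (#|tube_cells| <= (2 * C + 2) ^ #|I| * (2 * m + 1) ^ (d - #|I|))%N.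
Proof.
pose b i := if i \in I then (2 * C + 2)%N else (2 * m + 1)%N.
pose B := (2 * C + 2 + (2 * m + 1))%N.
(* A code for [z]: its free coordinates can be read off, they determine [slope_sum], and then the
   pivot coordinates can be read off too. Each pivot entry of the code has a range bounded in terms
   of [C] only. *)
pose s (z : cellT) i : int := if i \in I
  then (z i)%:Z - (z0 i)%:Z + (slope_sum i z %/ r.+1%:Z)%Z + C%:Z + 1
  else (z i)%:Z - (z0 i)%:Z + m%:Z.
have sP (z : cellT) i : z \in tube_cells -> 0 <= s z i < (b i)%:Z.
  rewrite inE => /forallP/(_ i); rewrite /s /b; case: ifP => iI; last by lia.
  set S := slope_sum i z.
  have Se := divz_eq S r.+1%:Z.
  have Sm : 0 <= (S %% r.+1%:Z)%Z < r.+1%:Z by rewrite modz_ge0// ltz_pmod.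
  move: Se Sm; set Q := (S %/ _)%Z; set M := (S %% _)%Z => -> Sm.
  set x := _ - _; set y : int := r.+1%:Z in Sm *; move=> h.
  have y0 : 0 < y by [].
  nia.
pose phi (z : cellT) : {ffun 'I_d -> 'I_B.+1} := [ffun i => inord `|s z i|%N].
have phiE (z : cellT) i : z \in tube_cells -> (phi z i : nat) = `|s z i|%N.
  move=> zA; have h := sP z i zA; rewrite ffunE inordK// ltnS.
  by move: h; rewrite /b /B; case: ifP; lia.
pose F i := [pred u : 'I_B.+1 | (u < b i)%N].
have phiF (z : cellT) : z \in tube_cells -> phi z \in family F.
  by move=> zA; apply/familyP => i; rewrite inE phiE//; have := sP _ i zA; lia.
have phi_inj : {in tube_cells &, injective phi}.
  move=> z z' zA zA' e.
  have se i : s z i = s z' i.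
    have := phiE _ i zA; rewrite e phiE//.
    by have := sP _ i zA; have := sP _ i zA'; lia.
  have zI i : i \notin I -> z i = z' i.
    move=> iI; have := se i; rewrite /s (negPf iI) => h.
    by apply: val_inj => /=; lia.
  apply/ffunP => i; have [iI|] := boolP (i \in I); last exact: zI.
  have := se i; rewrite /s iI.
  have -> : slope_sum i z = slope_sum i z'.
    by apply: eq_bigr => c cI; rewrite zI.
  by move=> h; apply: val_inj => /=; lia.
rewrite -(card_in_imset phi_inj).
apply: (@leq_trans #|family F|).
  by apply/subset_leq_card/fintype.subsetP => _ /imsetP[z /phiF zF ->].
rewrite card_family foldrE big_map big_enum/=.
have cF i : (#|F i| <= b i)%N.
  rewrite cardE -(size_map val) -(size_iota 0 (b i)) uniq_leq_size//.
    by rewrite map_inj_uniq ?enum_uniq//; exact: val_inj.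
  by move=> _ /mapP[u + ->]; rewrite mem_enum inE mem_iota.
rewrite (leq_trans (leq_prod (fun i _ => cF i)))//.
rewrite (bigID (mem I))/= leq_mul//.
  by rewrite (eq_bigr (fun=> 2 * C + 2)%N) ?prod_nat_const// => i; rewrite /b => ->.
rewrite (eq_bigr (fun=> 2 * m + 1)%N) => [|i]; last by rewrite /b => /negPf ->.
rewrite prod_nat_const leq_pexp2l ?addn1//.
rewrite -[X in (_ <= X - _)%N](card_ord d) -(cardC (mem I)) addKn.
by apply/subset_leq_card/fintype.subsetP.
Qed.

End tube_cells.

Section cells.
Context (R : realType) (d : nat).
Implicit Types (x y v : 'rV[R]_d) (V : 'M[R]_d).

Definition cell r y : {ffun 'I_d -> 'I_r.+1} :=
  [ffun i => inord (Num.truncn (r.+1%:R * y 0 i))].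

Lemma cellP r y i : torus R d y ->
  (cell r y i)%:R <= r.+1%:R * y 0 i < (cell r y i)%:R + 1.
Proof.
move=> /(_ i)/andP[y0 y1]; rewrite ffunE.
have h0 : 0 <= r.+1%:R * y 0 i by rewrite mulr_ge0.
have /andP[h1 h2] := truncn_itv h0.
rewrite inordK; first by rewrite natr1 h1 h2.
by rewrite -(ltr_nat R) (le_lt_trans h1)// gtr_pMr// ltr0n.
Qed.

Lemma cell_uniq r y (z : {ffun 'I_d -> 'I_r.+1}) : torus R d y ->
  (forall i, (z i)%:R <= r.+1%:R * y 0 i < (z i)%:R + 1) -> cell r y = z.
Proof.
move=> ty zy; apply/ffunP => i; apply: val_inj => /=.
have /andP[a1 a2] := cellP r y i ty; have /andP[b1 b2] := zy i.
have := le_lt_trans a1 b2; have := le_lt_trans b1 a2.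
by rewrite !natr1 !ltr_nat; lia.
Qed.

(** Each vector of the pivot basis of [V] gives one linear inequality, which nearly determines a
    pivot coordinate from the free ones. Measured in cells, rounding the points costs [d] and
    rounding the slopes another [d], hence [D + 2 * d]. *)
Lemma tube_cellsP V r q D : (0 < q)%N ->
  exists (I : {set 'I_d}) ell, #|I| = \rank V /\
  forall y y0, torus R d y -> torus R d y0 ->
    (forall v, (v <= V)%MS -> (forall i, `|v 0 i| <= 1) ->
       `|dotp v (y - y0)| <= D%:R / r.+1%:R) ->
    (forall i, `|y 0 i - y0 0 i| <= q%:R^-1) ->
    cell r y \in tube_cells d r (r.+1 %/ q).+1 (D + 2 * d) I ell (cell r y0).
Proof.
move=> q0; have [f [W [finj WV Wf W1]]] := rank_pivots R d _ V erefl.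
pose I : {set 'I_d} := [set f a | a in 'I_(\rank V)]%SET.
pose Wt i c := if [pick a | f a == i] is Some a then W a c else 0.
have WtE a c : Wt (f a) c = W a c.
  by rewrite /Wt; case: pickP => [b /eqP/finj->//|/(_ a)]; rewrite eqxx.
have Wt1 i c : `|Wt i c| <= 1 by rewrite /Wt; case: pickP; rewrite ?normr0.
pose ell : {ffun 'I_d * 'I_d -> 'I_(2 * r.+1).+1} :=
  [ffun ic => inord `|(Num.floor (r.+1%:R * Wt ic.1 ic.2) + r.+1%:Z)%R|%N].
exists I, ell; split; first by rewrite card_imset// card_ord.
have r0 : 0 < r.+1%:R :> R by rewrite ltr0n.
have ellE i c : `|r.+1%:R * Wt i c - ((ell (i, c))%:Z - r.+1%:Z)%:~R| <= 1.
  rewrite ffunE/=; set u := _ * _.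
  have u1 : `|u| <= r.+1%:R by rewrite normrM ger0_norm ?ler_piMr// ltW.
  have f1 : (Num.floor u)%:~R <= u by exact: floor_le.
  have f2 : u < (Num.floor u + 1)%:~R by exact: floorD1_gt.
  have n1 : - r.+1%:Z <= Num.floor u.
    by rewrite floor_ge_int mulrNz; move: u1; rewrite ler_norml => /andP[].
  have n2 : Num.floor u <= r.+1%:Z.
    rewrite -(ler_int R) (le_trans f1)// (le_trans (ler_norm _))//.
  rewrite inordK; last by lia.
  have -> : Posz `|(Num.floor u + r.+1%:Z)%R|%N - r.+1%:Z = Num.floor u by lia.
  by move: f2; rewrite intrD ger0_norm ?subr_ge0//; lra.
move=> y y0 ty ty0 Vy qy.
pose eta c : int := (cell r y c)%:Z - (cell r y0 c)%:Z.
have etaE c : `|(eta c)%:~R - r.+1%:R * (y 0 c - y0 0 c)| <= 1.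
  have /andP[a1 a2] := cellP r y c ty; have /andP[b1 b2] := cellP r y0 c ty0.
  rewrite /eta intrB -!pmulrn mulrBr ler_norml; apply/andP; split; lra.
have eta_r c : `|(eta c)%:~R| <= r.+1%:R :> R.
  have := ltn_ord (cell r y c); have := ltn_ord (cell r y0 c).
  rewrite /eta => h1 h2; rewrite -intr_norm -[leRHS]/((r.+1%:Z)%:~R) ler_int; lia.
rewrite inE; apply/forallP => i; case: ifPn => iI; last first.
  rewrite -/(eta i); have h : q%:R * `|(eta i)%:~R| <= (r.+1 + q)%:R :> R.
    have q0' : 0 < q%:R :> R by rewrite ltr0n.
    rewrite natrD -ler_pdivlMl// mulrDr mulVf ?gt_eqF//.
    have := qy i; have := etaE i.
    set e := (eta i)%:~R; set x := y 0 i - y0 0 i => h1 h2.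
    have h3 : `|r.+1%:R * x| <= r.+1%:R / q%:R.
      by rewrite normrM (ger0_norm (ltW r0)) ler_wpM2l// ltW.
    have -> : e = (e - r.+1%:R * x) + r.+1%:R * x by rewrite subrK.
    rewrite (le_trans (ler_normD _ _))// [q%:R^-1 * _]mulrC addrC; exact: lerD.
  have {}h : (q * `|eta i| <= r.+1 + q)%N.
    by rewrite -(ler_nat R) natrM natr_absz intr_norm.
  have : (`|eta i| <= (r.+1 + q) %/ q)%N by rewrite leq_divRL// mulnC.
  by rewrite divnDr// divnn q0 addn1; lia.
case/imsetP : iI => a _ ->.
rewrite -(ler_int R) intr_norm intrD intrM -/(eta (f a)) /slope_sum rmorph_sum/=.
under eq_bigr do rewrite intrM -/(eta _).
set L := fun c => ((ell (f a, c))%:Z - r.+1%:Z)%:~R : R.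
pose E c : R := (eta c)%:~R.
rewrite -/(E (f a)) (_ : \sum_(c | c \notin I) _ = \sum_(c | c \notin I) L c * E c)//.
have WE : \sum_c W a c * E c = E (f a) + \sum_(c | c \notin I) W a c * E c.
  rewrite (bigID (mem I))/=; congr (_ + _).
  rewrite (bigD1 (f a)) ?imset_f//= Wf eqxx mul1r big1 ?addr0// => c.
  case/andP => /imsetP[b _ ->] ba; rewrite Wf.
  by case: (eqVneq a b) ba => [->|_ _]; rewrite ?eqxx ?mul0r.
(* The true inequality, with exact slopes, minus the error of rounding the slopes. *)
have -> : r.+1%:~R * E (f a) + \sum_(c | c \notin I) L c * E c =
    r.+1%:R * (\sum_c W a c * E c) -
    \sum_(c | c \notin I) (r.+1%:R * W a c - L c) * E c.
  rewrite WE mulrDr -addrA; congr (_ + _); rewrite mulr_sumr -sumrB.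
  by apply: eq_bigr => c _; ring.
have h1 : `|\sum_c W a c * E c| <= D%:R + d%:R.
  have -> : \sum_c W a c * E c = r.+1%:R * dotp (row a W) (y - y0) +
      \sum_c W a c * (E c - r.+1%:R * (y 0 c - y0 0 c)).
    rewrite /dotp mulr_sumr -big_split/=; apply: eq_bigr => c _.
    by rewrite !mxE; ring.
  rewrite (le_trans (ler_normD _ _))// lerD//.
    rewrite normrM (ger0_norm (ltW r0)) -ler_pdivlMl// mulrC Vy//.
      by rewrite (submx_trans (row_sub _ _)).
    by move=> c; rewrite mxE.
  rewrite (le_trans (ler_norm_sum _ _ _))//.
  rewrite (@le_trans _ _ (\sum_(c < d) 1))//; last by rewrite sumr_const card_ord.
  by apply: ler_sum => c _; rewrite normrM mulr_ile1 ?normr_ge0 ?W1 ?etaE.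
have h2 : `|\sum_(c | c \notin I) (r.+1%:R * W a c - L c) * E c| <= d%:R * r.+1%:R.
  have -> : d%:R * r.+1%:R = \sum_(c < d) r.+1%:R :> R.
    by rewrite sumr_const card_ord mulr_natl.
  rewrite (le_trans (ler_norm_sum _ _ _))// big_mkcond ler_sum// => c _.
  case: ifP => _; last exact: ltW.
  rewrite normrM -[leRHS]mul1r ler_pM//; first by rewrite -WtE ellE.
  exact: eta_r.
rewrite (le_trans (ler_normB _ _))// normrM (ger0_norm (ltW r0)) intrM.
have -> : (D + 2 * d)%:~R * r.+1%:~R = r.+1%:R * (D%:R + d%:R) + d%:R * r.+1%:R :> R.
  by rewrite -!pmulrn natrD natrM; ring.
by rewrite lerD// ler_wpM2l// ltW.
Qed.

End cells.
Arguments cell {R d} r y.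
Arguments cellP {R d} r y i.
Arguments cell_uniq {R d} r y z.
Arguments tube_cellsP {R d} V r q D.

(** * The law of the centers *)

Lemma measure_finite_subadditive (disp : measure_display)
    (T : measurableType disp) (R : realType) (P : {measure set T -> \bar R})
    (I : finType) (Q : pred I) (F : I -> set T) :
  (forall i, measurable (F i)) ->
  measurable (\bigcup_(i in [set` Q]) F i) /\
  (P (\bigcup_(i in [set` Q]) F i) <= \sum_(i | Q i) P (F i))%E.
Proof.
move=> mF.
have -> : \bigcup_(i in [set` Q]) F i = \big[setU/set0]_(i <- enum Q) F i.
  by rewrite -bigcup_seq; apply: eq_bigcupl; split => i /=; rewrite mem_enum.
rewrite -big_enum; elim: (enum Q) => [|i s [mU IH]].
  by rewrite !big_nil measure0.
rewrite !big_cons; split; first exact: measurableU.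
by rewrite (le_trans (measureU2 _ (mF i) mU))// leeD2l.
Qed.

Lemma measurable_box (R : realType) d (a b : 'rV[R]_d) :
  measurable ([set y | forall i, a 0 i <= y 0 i < b 0 i] : set (borel_rV R d)).
Proof.
rewrite [X in measurable X](_ : _ = \bigcap_(i in [set: 'I_d])
    ([set y : 'rV[R]_d | y 0 i < b 0 i] `\` [set y | y 0 i < a 0 i])); last first.
  apply/seteqP; split => y /=.
    by move=> h i _; have /andP[h1 h2] := h i; split => //=; rewrite ltNge h1.
  by move=> h i; have [/= -> /negP] := h i I; rewrite -leNgt => ->.
have o (i : 'I_d) (t : R) : @measurable _ (borel_rV R d) [set y : 'rV[R]_d | y 0 i < t].
  apply: sub_gen_smallest; have := @open_comp _ _ (fun y : 'rV[R]_d => y 0 i) [set x | x < t].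
  by apply => [y _|]; [exact: coord_continuous | exact: open_lt].
apply: fin_bigcap_measurable => [|i _]; first exact: finite_finset.
by apply: measurableD; exact: o.
Qed.

(** The law of [xi n] is given on boxes inside the unit cube only, so corners of boxes are clamped
    to it. *)
Definition clamp01 {R : realType} (t : R) : R := Num.max 0 (Num.min 1 t).

Lemma clamp01E {R : realType} (t : R) :
  [\/ t <= 0 /\ clamp01 t = 0, 1 <= t /\ clamp01 t = 1 |
      0 <= t <= 1 /\ clamp01 t = t].
Proof.
rewrite /clamp01 minEle maxEle.
have [t1|t1] := leP 1 t; first by rewrite ler01; constructor 2.
by have [t0|t0] := leP 0 t; [constructor 3; rewrite ltW | constructor 1; rewrite ltW].
Qed.

Lemma clamp01_bounds {R : realType} (t : R) : 0 <= clamp01 t <= 1.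
Proof. by apply/andP; have [[? ->]|[? ->]|[/andP[? ?] ->]] := clamp01E t; lra. Qed.

Lemma clamp01_le {R : realType} (s t : R) : s <= t -> clamp01 s <= clamp01 t.
Proof.
by have [[? ->]|[? ->]|[/andP[? ?] ->]] := clamp01E t;
  have [[? ->]|[? ->]|[/andP[? ?] ->]] := clamp01E s; lra.
Qed.

Lemma clamp01_itv {R : realType} (s t u : R) : 0 <= u < 1 ->
  (clamp01 s <= u < clamp01 t) = (s <= u < t).
Proof.
by move=> /andP[? ?]; have [[? ->]|[? ->]|[/andP[? ?] ->]] := clamp01E t;
  have [[? ->]|[? ->]|[/andP[? ?] ->]] := clamp01E s;
  apply/andP/andP => -[? ?]; lra.
Qed.

(** An interval that wraps around the circle is cut into the parts with shift 0 and 1; by this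
    identity their total length does not depend on the position. *)
Lemma clamp01_sum {R : realType} (t : R) : -1 <= t <= 1 ->
  clamp01 t + clamp01 (t + 1) = t + 1.
Proof.
by move=> /andP[? ?]; have [[? ->]|[? ->]|[/andP[? ?] ->]] := clamp01E t;
  have [[? ->]|[? ->]|[/andP[? ?] ->]] := clamp01E (t + 1); lra.
Qed.

Section cell_law.
Context (disp : measure_display) (Omega : measurableType disp) (R : realType).
Context (P : probability Omega R) (d : nat).
Context (xi : nat -> {RV P >-> borel_rV R d}) (x : nat -> 'rV[R]_d).
Hypothesis xi_unif : forall n, uniform_on_torus (xi n).
Hypothesis xi_indep : mutually_independent xi.
Hypothesis xT : forall n, torus R d (x n).

Definition translate_center n w : 'rV[R]_d := torus_repr (xi n w + x n).

Lemma torus_torus_repr (y : 'rV[R]_d) : torus R d (torus_repr y).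
Proof.
move=> i; rewrite mxE subr_ge0 floor_le ltrBlDr addrC -intrD1.
exact: floorD1_gt.
Qed.

Let lo r n (z : {ffun 'I_d -> 'I_r.+1}) (s : {ffun 'I_d -> bool}) : 'rV[R]_d :=
  \row_i clamp01 ((z i)%:R / r.+1%:R - x n 0 i + (s i)%:R).
Let hi r n (z : {ffun 'I_d -> 'I_r.+1}) (s : {ffun 'I_d -> bool}) : 'rV[R]_d :=
  \row_i clamp01 (((z i)%:R + 1) / r.+1%:R - x n 0 i + (s i)%:R).

(* The set of positions of [xi n] for which the shifted point lies in a given
   cell: the shift splits the cell into at most [2 ^ d] boxes. *)
Definition cell_preim r n (z : {ffun 'I_d -> 'I_r.+1}) : set (borel_rV R d) :=
  \bigcup_(s in [set` predT])
    [set y : 'rV[R]_d | forall i, lo r n z s 0 i <= y 0 i < hi r n z s 0 i].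

Lemma measurable_cell_preim r n z : measurable (cell_preim r n z).
Proof.
apply: fin_bigcup_measurable => [|s _]; first exact: finite_finset.
exact: measurable_box.
Qed.

Lemma cell_preimE r n z w : cell r (translate_center n w) = z <-> cell_preim r n z (xi n w).
Proof.
have r0 : 0 < r.+1%:R :> R by rewrite ltr0n.
have [/(_ w) uT _] := xi_unif n; have cT : torus R d (translate_center n w) := torus_torus_repr _.
pose u : 'rV[R]_d := xi n w; rewrite -/u in uT.
split=> [<-|[s _ /= h]].
  (* [s] records the coordinates in which the sum leaves the unit cube and 1 is subtracted. *)
  pose s := [ffun i => (1 <= u 0 i + x n 0 i)%R].
  have sE i : s i = (1 <= u 0 i + x n 0 i)%R by rewrite ffunE.
  exists s => //= i; rewrite !mxE clamp01_itv ?uT// sE.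
  have /andP[h1 h2] := cellP r _ i cT; move: h1 h2.
  rewrite -ler_pdivrMl// -ltr_pdivlMl// ![r.+1%:R^-1 * _]mulrC.
  have -> : translate_center n w 0 i = u 0 i + x n 0 i - (1 <= u 0 i + x n 0 i)%R%:R.
    rewrite !mxE; congr (_ - _); rewrite (floor_def (m := (1 <= u 0 i + x n 0 i)%R%:Z)).
      by rewrite -pmulrn.
    have /andP[a1 a2] := uT i; have /andP[b1 b2] := xT n i.
    rewrite -/u; case: (leP 1 (u 0 i + x n 0 i)) => ?; rewrite ?intrD -!pmulrn /=; apply/andP; split; lra.
  rewrite -/u; move: (_ / _) (_ / _) (nat_of_bool _)%:R => A B C h1 h2.
  by apply/andP; split; lra.
apply: (cell_uniq r _ z cT) => i; have := h i; rewrite !mxE clamp01_itv ?uT// => /andP[h1 h2].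
have z1 : ((z i)%:R + 1) / r.+1%:R <= 1 :> R.
  by rewrite ler_pdivrMr// mul1r natr1 ler_nat.
have z0 : 0 <= (z i)%:R / r.+1%:R :> R by rewrite divr_ge0.
rewrite -ler_pdivrMl// -ltr_pdivlMl// ![r.+1%:R^-1 * _]mulrC -/u in h1 h2 *.
move: h1 h2 z0 z1; move: (_ / _) (_ / _) => A B h1 h2 z0 z1.
rewrite (floor_def (m := (s i)%:Z)); last first.
  rewrite intrD -!pmulrn; move: (nat_of_bool _)%:R h1 h2 => C h1 h2.
  by apply/andP; split; lra.
rewrite -pmulrn; move: (nat_of_bool _)%:R h1 h2 => C h1 h2.
by apply/andP; split; lra.
Qed.

Lemma cell_preim_le r n z : (P (xi n @^-1` cell_preim r n z) <= ((r.+1 ^ d)%:R^-1)%:E)%E.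
Proof.
have r0 : 0 < r.+1%:R :> R by rewrite ltr0n.
pose box s := [set y : 'rV[R]_d | forall i, lo r n z s 0 i <= y 0 i < hi r n z s 0 i].
have mbox s : measurable (box s : set (borel_rV R d)) by exact: measurable_box.
have [_ le_sum] := measure_finite_subadditive _ _ _ (distribution P (xi n)) _ predT box mbox.
apply: (le_trans le_sum).
have [_ unif] := xi_unif n.
have lohi s i : lo r n z s 0 i <= hi r n z s 0 i.
  rewrite !mxE clamp01_le// lerD2r lerD2r ler_wpM2r ?invr_ge0 ?ltW//; lra.
rewrite (eq_bigr (fun s => (\prod_i (hi r n z s 0 i - lo r n z s 0 i))%:E)); last first.
  move=> s _; apply: unif => i; rewrite lohi.
  by rewrite !mxE; split; [have /andP[] := clamp01_bounds ((z i)%:R / r.+1%:R - x n 0 i + (s i)%:R)|split => //; have /andP[] := clamp01_bounds (((z i)%:R + 1) / r.+1%:R - x n 0 i + (s i)%:R)].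
rewrite sumEFin lee_fin.
under eq_bigr do under eq_bigr do rewrite !mxE.
(* The sum over [s] of the volumes factorizes into a product over the coordinates; in each of them
   the two parts have total length [1 / r.+1]. *)
pose G i (b : bool) := clamp01 (((z i)%:R + 1) / r.+1%:R - x n 0 i + b%:R) -
  clamp01 ((z i)%:R / r.+1%:R - x n 0 i + b%:R).
rewrite -(bigA_distr_bigA G)/= (eq_bigr (fun=> r.+1%:R^-1)) => [|i _].
  by rewrite prodr_const card_ord natrX exprVn.
have /andP[b1 b2] := xT n i.
have z1 : ((z i)%:R + 1) / r.+1%:R <= 1 :> R.
  by rewrite ler_pdivrMr// mul1r natr1 ler_nat.
have z0 : 0 <= (z i)%:R / r.+1%:R :> R by rewrite divr_ge0.
have zz : ((z i)%:R + 1) / r.+1%:R = (z i)%:R / r.+1%:R + r.+1%:R^-1 :> R.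
  by rewrite mulrDl mul1r.
have rV : 0 < r.+1%:R^-1 :> R by rewrite invr_gt0.
rewrite big_bool /G/= mulr1n mulr0n !addr0.
move: zz z0 z1 rV; set B := (_ + 1) / _; set A := _ / _; set C := _^-1.
move: A B C => A B C -> z0 z1 rV.
have := clamp01_sum (A - x n 0 i); have := clamp01_sum (A + C - x n 0 i).
by move=> h1 h2; have := h1 _; have := h2 _; lra.
Qed.

(** By independence every list of cells has probability at most its uniform weight, so the counting
    bounds above become bounds on probabilities. *)
Lemma block_law r i0 N (F : pred {ffun 'I_N -> {ffun 'I_d -> 'I_r.+1}}) :
  let X w := [ffun j : 'I_N => cell r (translate_center (i0 + j)%N w)] in
  measurable [set w | F (X w)] /\
  (P [set w | F (X w)] <= (#|F|%:R / ((r.+1 ^ d) ^ N)%:R)%:E)%E.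
Proof.
move=> X.
(* Only indices of the block are used below, where [n - i0] is the position in the block; [setT] is
   a default value. *)
pose B (f : {ffun 'I_N -> {ffun 'I_d -> 'I_r.+1}}) (n : nat) : set (borel_rV R d) :=
  if (insub (n - i0)%N : option 'I_N) is Some j then cell_preim r n (f j) else setT.
pose E (f : {ffun 'I_N -> {ffun 'I_d -> 'I_r.+1}}) :=
  \bigcap_(n in [set` iota i0 N]) (xi n @^-1` B f n).
have mB f n : measurable (B f n).
  by rewrite /B; case: insubP => // *; exact: measurable_cell_preim.
have mE f : measurable (E f).
  apply: fin_bigcap_measurable => [|n _]; first exact: finite_seq.
  by rewrite -[X in measurable X]setTI; exact: measurable_funP.
have XE : [set w | F (X w)] = \bigcup_(f in [set` F]) E f.
  apply/seteqP; split => w /=.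
    move=> Fw; exists (X w) => // n /=; rewrite mem_iota => /andP[n1 n2].
    rewrite /B insubT/=; first by lia.
    move=> nN; apply/cell_preimE; rewrite ffunE/= subnKC//.
  case=> f /= Ff wE; rewrite (_ : X w = f)//; apply/ffunP => j; rewrite ffunE.
  apply/cell_preimE; have := wE (i0 + j)%N.
  rewrite /= mem_iota leq_addr ltn_add2l ltn_ord => /(_ isT).
  rewrite /B; case: insubP => [k _ kj|]; last by rewrite addKn ltn_ord.
  by rewrite (_ : k = j)//; apply: val_inj; rewrite kj addKn.
rewrite XE; have [? le_sum] := measure_finite_subadditive _ _ _ P _ F E mE.
split => //; apply: (le_trans le_sum).
have PE f : (P (E f) <= ((((r.+1 ^ d) ^ N)%:R)^-1)%:E)%E.
  rewrite /E xi_indep ?iota_uniq//.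
  have p1 n : n \in iota i0 N -> (P (xi n @^-1` B f n) <= ((r.+1 ^ d)%:R^-1)%:E)%E.
    rewrite mem_iota => /andP[n1 n2]; rewrite /B insubT/=; first by lia.
    by move=> ?; exact: cell_preim_le.
  rewrite -[X in ((r.+1 ^ d) ^ X)%N](size_iota i0 N).
  elim: (iota i0 N) p1 => [|n s IH] p1; first by rewrite big_nil/= expn0 invr1.
  rewrite big_cons/= expnS natrM invfM EFinM lee_pmul//.
  - by rewrite prode_ge0.
  - by apply: p1; rewrite mem_head.
  - by apply: IH => m ms; apply: p1; rewrite in_cons ms orbT.
rewrite (le_trans (lee_sum _ (fun f _ => PE f)))//.
by rewrite sumEFin lee_fin sumr_const mulr_natl.
Qed.

End cell_law.
Arguments translate_center {disp Omega R P d} xi x n w.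
Arguments block_law {disp Omega R P d} xi x _ _ _ r i0 N F.
Arguments torus_torus_repr {R d} y.

(** * Distribution of the centers of a block among cells and tubes *)

Section block_estimates.
Context (disp : measure_display) (Omega : measurableType disp) (R : realType).
Context (P : probability Omega R) (d : nat).
Context (xi : nat -> {RV P >-> borel_rV R d}) (x : nat -> 'rV[R]_d).
Hypothesis xi_unif : forall n, uniform_on_torus (xi n).
Hypothesis xi_indep : mutually_independent xi.
Hypothesis xT : forall n, torus R d (x n).
Local Notation c := (translate_center xi x).

Let card_cell r : #|{ffun 'I_d -> 'I_r.+1}| = (r.+1 ^ d)%N.
Proof. by rewrite card_ffun !card_ord. Qed.

Lemma block_event r i0 N (F : pred {ffun 'I_N -> {ffun 'I_d -> 'I_r.+1}}) (e : R) :
  #|F|%:R <= (r.+1 ^ d)%:R ^+ N * e ->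
  let X w := [ffun j : 'I_N => cell r (c (i0 + j)%N w)] in
  measurable [set w | F (X w)] /\ (P [set w | F (X w)] <= e%:E)%E.
Proof.
move=> Fe X; have [mF PF] := block_law xi x xi_unif xi_indep xT r i0 N F.
split => //; apply: (le_trans PF); rewrite lee_fin natrX ler_pdivrMr ?exprn_gt0 ?ltr0n ?expn_gt0//.
by rewrite mulrC.
Qed.

(** A union bound over all cells of [chernoff_lower], where a single cell has probability
    [1 / (r.+1 ^ d)]. *)
Lemma empty_cell_event r i0 N :
  exists B, [/\ measurable B,
    (P B <= ((r.+1 ^ d)%:R * expR (- (N%:R / (r.+1 ^ d)%:R / 4)))%:E)%E &
    forall w, ~ B w -> forall z : {ffun 'I_d -> 'I_r.+1},
      N%:R / (r.+1 ^ d)%:R / 4 <= #|[pred j : 'I_N | cell r (c (i0 + j)%N w) == z]|%:R :> R].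
Proof.
pose X w := [ffun j : 'I_N => cell r (c (i0 + j)%N w)].
pose h : R := N%:R / (r.+1 ^ d)%:R / 4.
pose F (z : {ffun 'I_d -> 'I_r.+1}) := [pred f : {ffun 'I_N -> {ffun 'I_d -> 'I_r.+1}} |
  (hits _ _ [set z]%SET f)%:R <= h].
have Fev z := block_event r i0 N (F z) (expR (- h)).
have cF z : #|F z|%:R <= (r.+1 ^ d)%:R ^+ N * expR (- h).
  have := @chernoff_lower R _ N [set z]%SET; rewrite card_cell cards1 => /(_ _)/=.
  by rewrite expn_gt0/= mul1r [_^-1 * _]mulrC => /(_ isT).
have mF z : measurable [set w | F z (X w)] by have [] := Fev z (cF z).
have [mB PB] := measure_finite_subadditive _ _ _ P _ predT _ mF.
exists (\bigcup_(z in [set` predT]) [set w | F z (X w)]); split => //.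
  apply: (le_trans PB); rewrite (le_trans (lee_sum _ (fun z _ => (Fev z (cF z)).2)))//.
  by rewrite sumEFin lee_fin sumr_const card_cell mulr_natl.
move=> w wB z; rewrite leNgt; apply/negP => hz; apply: wB.
exists z => //=; rewrite -/h (le_trans _ (ltW hz))// ler_nat.
apply/subset_leq_card/fintype.subsetP => j; rewrite !inE ffunE => /eqP ->; exact: eqxx.
Qed.

(** Pivots, rounded slopes and base cell of a discretized tube. For fixed [d] their number is
    polynomial in [r], hence harmless against an exponentially small probability. *)
Definition tube_param r : finType :=
  ({set 'I_d} * {ffun 'I_d * 'I_d -> 'I_(2 * r.+1).+1} * {ffun 'I_d -> 'I_r.+1})%type.

Lemma card_tube_param r : #|{: tube_param r}| =
  (2 ^ d * (2 * r.+1).+1 ^ (d * d) * r.+1 ^ d)%N.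
Proof.
rewrite !card_prod card_cell -cardsT -powersetT card_powerset cardsT.
by rewrite card_ffun card_prod !card_ord.
Qed.

(** A union bound of [chernoff_upper] over the discretized tubes. Since every true tube is contained
    in one of these, a single exceptional event serves all [V] and [S] at once. *)
Lemma crowded_tube_event r i0 N q D (M : R) : 0 <= M -> (0 < q <= r.+1)%N ->
  exists B, [/\ measurable B,
    (P B <= ((2 ^ d * (2 * r.+1).+1 ^ (d * d) * r.+1 ^ d)%:R * expR (- M))%:E)%E &
    forall w, ~ B w -> forall (V : 'M[R]_d) (S : {set 'I_N}),
      (forall j l, j \in S -> l \in S ->
        (forall v, (v <= V)%MS -> (forall i, `|v 0 i| <= 1) ->
         `|dotp v (c (i0 + j)%N w - c (i0 + l)%N w)| <= D%:R / r.+1%:R) /\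
        (forall i, `|c (i0 + j)%N w 0 i - c (i0 + l)%N w 0 i| <= q%:R^-1)) ->
      #|S|%:R <= 3 * (10 * (D + 2 * d) + 10)%:R ^+ d * q%:R ^+ (\rank V)
                 * N%:R / (r.+1%:R ^+ (\rank V) * q%:R ^+ d) + M].
Proof.
move=> M0 /andP[q0 qr].
pose X w := [ffun j : 'I_N => cell r (c (i0 + j)%N w)].
pose C := (D + 2 * d)%N; pose m := (r.+1 %/ q).+1.
pose A (p : tube_param r) := tube_cells d r m C p.1.1 p.1.2 p.2.
pose F p := [pred f : {ffun 'I_N -> {ffun 'I_d -> 'I_r.+1}} |
  3 * (#|A p|%:R / (r.+1 ^ d)%:R * N%:R) + M <= (hits _ _ (A p) f)%:R].
have Fev p := block_event r i0 N (F p) (expR (- M)).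
have cF p : #|F p|%:R <= (r.+1 ^ d)%:R ^+ N * expR (- M).
  have := @chernoff_upper R _ N (A p); rewrite card_cell; apply.
  by rewrite expn_gt0.
have mF p : measurable [set w | F p (X w)] by have [] := Fev p (cF p).
have [mB PB] := measure_finite_subadditive _ _ _ P _ predT _ mF.
exists (\bigcup_(p in [set` predT]) [set w | F p (X w)]); split => //.
  apply: (le_trans PB); rewrite (le_trans (lee_sum _ (fun p _ => (Fev p (cF p)).2)))//.
  by rewrite sumEFin lee_fin sumr_const card_tube_param mulr_natl.
move=> w wB V S SV.
have q0R : 0 < q%:R :> R by rewrite ltr0n.
have r0R : 0 < r.+1%:R :> R by rewrite ltr0n.
have [->|[j0 j0S]] := set_0Vmem S.
  by rewrite cards0 addr_ge0// !mulr_ge0 ?invr_ge0 ?mulr_ge0 ?exprn_ge0 ?ler0n.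
have [I [ell [cI tubeP]]] := tube_cellsP V r q D q0.
(* Any point of [S] can be the base: all others lie in the tube around its cell. *)
pose p : tube_param r := (I, ell, cell r (c (i0 + j0)%N w)).
have wF : (hits _ _ (A p) (X w))%:R < 3 * (#|A p|%:R / (r.+1 ^ d)%:R * N%:R) + M.
  by rewrite ltNge; apply/negP => h; apply: wB; exists p.
have Sh : #|S|%:R <= (hits _ _ (A p) (X w))%:R :> R.
  rewrite ler_nat; apply/subset_leq_card/fintype.subsetP => j jS.
  rewrite inE ffunE; have [h1 h2] := SV j j0 jS j0S.
  by apply: tubeP => //; exact: torus_torus_repr.
rewrite (le_trans Sh)// (le_trans (ltW wF))// lerD2r.
set K := (10 * _ + 10)%:R ^+ d; set Z := (r.+1%:R ^+ _ * _)^-1.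
rewrite (_ : 3 * K * _ * _ * Z = 3 * (K * (q%:R ^+ \rank V * Z) * N%:R)); last by ring.
rewrite ler_pM2l// ler_wpM2r// /K /Z.
have kd : (\rank V <= d)%N by exact: rank_leq_row.
have := card_tube_cells d r m C I ell (cell r (c (i0 + j0)%N w)).
rewrite -/(A p) cI; set k := \rank V in kd * => cA.
(* As [q <= r.+1], the integer quotient is at least 1 and absorbs the additive constants. *)
have m5 : (2 * m + 1)%:R <= 5 * (r.+1%:R / q%:R) :> R.
  have dq : (0 < r.+1 %/ q)%N by rewrite divn_gt0.
  apply: (@le_trans _ _ (5 * (r.+1 %/ q))%:R); first by rewrite ler_nat /m; lia.
  rewrite natrM ler_pM2l// ler_pdivlMr// -natrM ler_nat; exact: leq_trunc_div.
have {}cA : #|A p|%:R <= (10 * C + 10)%:R ^+ d * (r.+1%:R / q%:R) ^+ (d - k) :> R.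
  have := cA; rewrite -(ler_nat R) => /le_trans; apply.
  rewrite natrM !natrX -{2}(subnKC kd) exprD -mulrA ler_pM ?exprn_ge0//.
    by rewrite lerXn2r ?nnegrE// ler_nat; lia.
  rewrite -exprMn lerXn2r ?nnegrE ?mulr_ge0 ?invr_ge0//.
  rewrite (le_trans m5)// ler_wpM2r ?divr_ge0// ler_nat; lia.
rewrite natrX ler_pdivrMr ?exprn_gt0// (le_trans cA)//.
rewrite -!mulrA ler_wpM2l ?exprn_ge0//.
rewrite -{2 3}(subnKC kd) !exprD expr_div_n.
rewrite le_eqVlt; apply/orP; left; apply/eqP; field.
by rewrite ?expf_neq0 ?gt_eqF.
Qed.

End block_estimates.

(** * Choice of scales and blocks *)

Section scales.
Context {R : realType}.

Lemma near_powR_ge (a A : R) : 0 < a -> \forall Q \near \oo, A <= Q%:R `^ a.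
Proof.
move=> a0; near=> Q.
have h0 : 0 <= (`|A| + 1) `^ a^-1 by exact: powR_ge0.
have Qge : (`|A| + 1) `^ a^-1 <= Q%:R by near: Q; exact: nbhs_infty_ger.
rewrite (@le_trans _ _ (`|A| + 1))//; first by rewrite (le_trans (ler_norm _))// lerDl.
rewrite -[leLHS]powRr1 ?addr_ge0// -[X in _ `^ X](@mulVf _ a) ?gt_eqF//.
by rewrite powRrM; apply: ge0_ler_powR; rewrite ?nnegrE // ltW.
Unshelve. all: by end_near. Qed.

Lemma near_powR_le (a A : R) : a < 0 -> 0 < A -> \forall Q \near \oo, Q%:R `^ a <= A.
Proof.
move=> a0 A0; near=> Q.
have : A^-1 <= Q%:R `^ (- a) by near: Q; apply: near_powR_ge; rewrite oppr_gt0.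
rewrite powRN => h; have Qa : 0 < Q%:R `^ a.
  by rewrite -invr_gt0 (lt_le_trans _ h)// invr_gt0.
by rewrite -lef_pV2 ?posrE.
Unshelve. all: by end_near. Qed.

Lemma expRN_le_fact (n : nat) (y : R) : 0 < y -> expR (- y) <= n`!%:R / y ^+ n.
Proof.
move=> y0; rewrite expRN -[_ / _]invrK lef_pV2 ?posrE ?expR_gt0 ?invr_gt0 ?divr_gt0 ?exprn_gt0 ?ltr0n ?fact_gt0//.
rewrite invfM invrK mulrC; case: n => [|n]; first by rewrite expr0 fact0 invr1 mulr1 -expR0 ler_expR ltW.
by apply: le_trans (expR_ge1Dxn n (ltW y0)); rewrite lerDr.
Qed.

Lemma near_poly_expRN (D : nat) (eps C eta : R) : 0 < eps -> 0 < eta -> 0 <= C ->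
  \forall Q \near \oo, C * Q%:R ^+ D * expR (- Q%:R `^ eps) <= eta.
Proof.
move=> e0 eta0 C0.
(* The exponent leaves a spare factor [Q], which beats all constants. *)
have [n nP] : exists n : nat, D%:R + 1 <= n%:R * eps.
  exists (Num.truncn ((D%:R + 1) / eps)).+1; rewrite -ler_pdivrMr// ltW//.
  have /truncn_itv/andP[]// : 0 <= (D%:R + 1) / eps by rewrite divr_ge0 ?addr_ge0// ltW.
near=> Q.
have Q1 : 1 <= Q%:R :> R by near: Q; exact: nbhs_infty_ger.
have Q0 : 0 < Q%:R :> R by exact: lt_le_trans Q1.
have QC : C * n`!%:R / eta <= Q%:R by near: Q; exact: nbhs_infty_ger.
have Qe : 0 < Q%:R `^ eps by exact: powR_gt0.
apply: le_trans (ler_wpM2l _ (expRN_le_fact n _ Qe)) _.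
  by rewrite mulr_ge0// exprn_ge0// ltW.
have -> : (Q%:R `^ eps) ^+ n = Q%:R `^ (n%:R * eps).
  by rewrite mulrC powRrM powR_mulrn ?powR_ge0.
have h : Q%:R ^+ D * Q%:R <= Q%:R `^ (n%:R * eps) :> R.
  by rewrite -exprSr -(powR_mulrn _ (ltW Q0)); apply: ler_powR => //; rewrite -natr1.
rewrite mulrA ler_pdivrMr ?powR_gt0//; apply: le_trans (ler_wpM2l (ltW eta0) h).
rewrite ler_pdivrMr// in QC; rewrite mulrAC [leRHS]mulrCA [leLHS]mulrC ler_wpM2l//.
by rewrite [leRHS]mulrC.
Unshelve. all: by end_near. Qed.

(** For fixed [q] all three hold once [Q] is large. In the second, [t < k] makes the expected number
    of points in a tube negligible and [t + eps < s] the excess. The third adds the probabilities of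
    a poor cell and of a crowded tube, the latter over at most [q'] widths. *)
Lemma scale_conditions (d q k : nat) (s t eps K eta : R) : (0 < d)%N -> (0 < q)%N ->
  0 < eps -> 0 <= t -> t + eps < s -> t < k%:R -> 0 <= K -> 0 < eta ->
  \forall Q \near \oo, forall N : nat, Q%:R `^ s <= N%:R ->
    let q' := (2 * d * Q)%N in
    [/\ (3 * q <= q')%N,
        (K * q%:R ^+ k * N%:R / (q'%:R ^+ k * q%:R ^+ d) + Q%:R `^ eps) * q'%:R `^ t
          <= N%:R / (8 * 3 ^+ d * q%:R ^+ d) &
        ((3 * q) ^ d)%:R * expR (- (N%:R / ((3 * q) ^ d)%:R / 4)) +
        q'%:R * (2 ^ d * (2 * q').+1 ^ (d * d) * q' ^ d)%:R * expR (- Q%:R `^ eps)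
        <= eta].
Proof.
move=> d0 q0 e0 t0 ts tk K0 eta0.
pose a := (2 * d)%N; have a1 : 1 <= a%:R :> R by rewrite ler1n muln_gt0.
(* Twice [8 * 3 ^+ d]: the expected number and the excess each get half of the allowance. *)
pose B : R := 16 * 3 ^+ d.
have B0 : 0 < B by rewrite mulr_gt0// exprn_gt0.
have qR : 0 < q%:R :> R by rewrite ltr0n.
have qd : 0 < q%:R ^+ d :> R by rewrite exprn_gt0.
pose C : R := (a * (2 ^ d * (3 * a) ^ (d * d) * a ^ d))%:R.
have n3 : 0 < ((3 * q) ^ d)%:R :> R by rewrite ltr0n expn_gt0 muln_gt0 q0.
have Kq : 0 <= K * q%:R ^+ k by rewrite mulr_ge0// exprn_ge0// ltW.
have F1 : \forall Q \near \oo, Q%:R `^ (t - k%:R) <= ((K * q%:R ^+ k + 1) * B)^-1 :> R.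
  apply: near_powR_le; first by rewrite subr_lt0.
  by rewrite invr_gt0 mulr_gt0// ltr_wpDl.
have F2 : \forall Q \near \oo, a%:R `^ t * (B * q%:R ^+ d) <= Q%:R `^ (s - (t + eps)).
  by apply: near_powR_ge; rewrite subr_gt0.
have F3 : \forall Q \near \oo,
    8 * ((3 * q) ^ d)%:R * ((3 * q) ^ d)%:R / eta <= Q%:R `^ s.
  by apply: near_powR_ge; rewrite (lt_trans _ ts)// ltr_wpDl.
have F4 : \forall Q \near \oo,
    C * Q%:R ^+ (1 + d * d + d) * expR (- Q%:R `^ eps) <= eta / 2.
  by apply: near_poly_expRN => //; rewrite divr_gt0.
have F5 : \forall Q \near \oo, (3 * q < Q)%N by exact: nbhs_infty_gt.
apply: filterS (filterI F1 (filterI F2 (filterI F3 (filterI F4 F5)))) => Q.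
move=> [Qs [h [h3 [h4 Q3]]]] N QN; set q' := (2 * d * Q)%N.
have Q1 : (0 < Q)%N by exact: leq_ltn_trans Q3.
have X1 : 1 <= Q%:R :> R by rewrite ler1n.
have X0 : 0 < Q%:R :> R by exact: lt_le_trans X1.
have q'E : q'%:R = a%:R * Q%:R :> R by rewrite -natrM.
have q'0 : 0 < q'%:R :> R by rewrite q'E mulr_gt0// (lt_le_trans _ a1).
have N0 : 0 < N%:R :> R by rewrite (lt_le_trans _ QN)// powR_gt0.
split.
- by rewrite (leq_trans (ltnW Q3))// leq_pmull// muln_gt0.
- have -> : N%:R / (8 * 3 ^+ d * q%:R ^+ d) = N%:R / (B * q%:R ^+ d) + N%:R / (B * q%:R ^+ d).
    by rewrite /B; field; rewrite ?gt_eqF// exprn_gt0.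
  rewrite mulrDl lerD//.
    have q't : q'%:R `^ t / q'%:R ^+ k <= Q%:R `^ (t - k%:R).
      rewrite -powR_mulrn ?(ltW q'0)// -powRB; last by rewrite (gt_eqF q'0) implybT.
      rewrite q'E powRM ?(le_trans ler01)// ler_piMl ?powR_ge0//.
      rewrite -(opprB k%:R) powRN invf_le1 ?powR_gt0 ?(lt_le_trans ltr01)//.
      have kt : 0 <= k%:R - t by rewrite subr_ge0 ltW.
      by have := ler_powR a1 kt; rewrite powRr0.
    have -> : K * q%:R ^+ k * N%:R / (q'%:R ^+ k * q%:R ^+ d) * q'%:R `^ t =
        (N%:R / q%:R ^+ d) * (K * q%:R ^+ k * (q'%:R `^ t / q'%:R ^+ k)).
      rewrite invfM; move: (_ ^+ k)^-1 (_ ^+ d)^-1 (_ `^ _) => u v y; ring.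
    rewrite [B * _]mulrC invfM [leRHS]mulrA ler_wpM2l//.
    rewrite (le_trans (ler_wpM2l Kq (le_trans q't Qs)))//.
    rewrite invfM mulrA ler_piMl ?invr_ge0 ?(ltW B0)//.
    by rewrite ler_pdivrMr ?mul1r ?lerDl// ltr_wpDl.
  have -> : Q%:R `^ eps * q'%:R `^ t = a%:R `^ t * Q%:R `^ (t + eps).
    rewrite q'E powRM ?(le_trans ler01)//.
    rewrite [Q%:R `^ (t + eps)]powRD ?(gt_eqF X0) ?implybT//; ring.
  rewrite ler_pdivlMr ?mulr_gt0// mulrAC (le_trans _ QN)//.
  rewrite (le_trans (ler_wpM2r _ h)) ?powR_ge0// -powRD ?subrK//.
  by rewrite (gt_eqF X0) implybT.
- have -> : eta = eta / 2 + eta / 2 by lra.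
  rewrite lerD//.
    set n3q := ((3 * q) ^ d)%:R in n3 h3 *.
    have y0 : 0 < N%:R / n3q / 4 by rewrite !divr_gt0.
    have := expRN_le_fact 1 _ y0; rewrite expr1 (factS 0) fact0 muln1 div1r => /(ler_wpM2l (ltW n3)).
    move/le_trans; apply; rewrite !invf_div mulrCA !mulrA ler_pdivrMr//.
    have := le_trans h3 QN; rewrite ler_pdivrMr// => h'; lra.
  apply: (@le_trans _ _ (C * Q%:R ^+ (1 + d * d + d) * expR (- Q%:R `^ eps))).
    rewrite ler_wpM2r ?expR_ge0// /C -natrX -!natrM ler_nat !expnD expn1.
    have -> : (a * (2 ^ d * (3 * a) ^ (d * d) * a ^ d) * (Q * Q ^ (d * d) * Q ^ d) =
      (a * Q) * (2 ^ d * (3 * (a * Q)) ^ (d * d) * (a * Q) ^ d))%N.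
      by rewrite mulnA !expnMn; ring.
    rewrite leq_mul// leq_mul// leq_mul// leq_exp2r ?muln_gt0 ?d0// /q' /a.
    by rewrite ltn_mul2r !muln_gt0 d0 Q1.
  exact: h4.
Qed.

End scales.

Section blocks.
Context {R : realType}.

(** The integral test in discrete form: [expR (b * L) >= 1 + b * L], where [L], the logarithm of
    [n.+1 / n], is at least [1 / n.+1]. *)
Lemma powR_telescope (b : R) (n : nat) : 0 < b -> (0 < n)%N ->
  b * n.+1%:R `^ (- (1 + b)) <= n%:R `^ (- b) - n.+1%:R `^ (- b).
Proof.
move=> b0 n0; have n0R : 0 < n%:R :> R by rewrite ltr0n.
have n1 : 0 < n.+1%:R :> R by rewrite ltr0n.
rewrite opprD powRD; last by rewrite (gt_eqF n1) implybT.
rewrite (powR_inv1 (ltW n1)).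
have -> : n%:R `^ (- b) = n.+1%:R `^ (- b) * expR (b * (ln n.+1%:R - ln n%:R)).
  rewrite /powR !gt_eqF// -expRD; congr expR; ring.
have : n.+1%:R^-1 <= ln n.+1%:R - ln n%:R :> R.
  have := @le_ln1Dx R (- n.+1%:R^-1) _.
  rewrite (_ : 1 + - n.+1%:R^-1 = n%:R / n.+1%:R); last by rewrite -natr1; field; rewrite natr1 gt_eqF.
  rewrite ltrN2 invf_lt1// ltr1n => /(_ n0).
  by rewrite ln_div ?posrE// => h; rewrite -lerN2 opprB.
set L := _ - _; move=> nL.
have E := expR_ge1Dx (b * L); have P0 := powR_gt0 (- b) n1.
set p := _ `^ _ in P0 *; set e := expR _ in E *.
have : b * n.+1%:R^-1 <= b * L by rewrite ler_pM2l.
rewrite mulrA => h; rewrite -[X in _ - X]mulr1 -mulrBr [leLHS]mulrC ler_pM2l//.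
by rewrite (le_trans h)// lerBrDl.
Qed.

Lemma series_lt_pinfty_bounded (v : nat -> R) (B : R) : (forall n, 0 <= v n) ->
  (forall M, \sum_(0 <= n < M) v n <= B) -> (\sum_(0 <= n <oo) (v n)%:E < +oo)%E.
Proof.
move=> v0 vB; apply: (@le_lt_trans _ _ B%:E); last exact: ltry.
apply: lime_le; first by apply: is_cvg_nneseries => n _ _; rewrite lee_fin.
by apply: nearW => M; rewrite sumEFin lee_fin.
Qed.

Lemma dominated_zeta_series (v : nat -> R) (b : R) (m : nat) : 0 < b ->
  (forall n, 0 <= v n) -> (forall n, (m <= n)%N -> v n <= n.+1%:R `^ (- (1 + b))) ->
  (\sum_(0 <= n <oo) (v n)%:E < +oo)%E.
Proof.
(* The telescoping bound needs a positive index, hence [m.+1]. *)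
move=> b0 v0 vm; pose m1 := m.+1.
apply: (@series_lt_pinfty_bounded _ (\sum_(0 <= n < m1) v n + b^-1 * m1%:R `^ (- b))) => // M.
apply: (@le_trans _ _ (\sum_(0 <= n < m1 + M) v n)).
  have [Mm|/ltnW] := leqP M (m1 + M); last by lia.
  by rewrite (@big_cat_nat _ _ _ M 0 (m1 + M))//= lerDl sumr_ge0.
apply: (@le_trans _ _ (\sum_(0 <= n < m1) v n + b^-1 * (m1%:R `^ (- b) - (m1 + M)%:R `^ (- b)))).
  elim: M => [|M IH]; first by rewrite addn0 subrr mulr0 addr0.
  rewrite addnS big_nat_recr//=.
  have h1 := vm (m1 + M)%N ltac:(rewrite /m1; lia).
  have h2 := powR_telescope b (m1 + M) b0 isT.
  have {}h1 : v (m1 + M)%N <= b^-1 * ((m1 + M)%:R `^ (- b) - (m1 + M).+1%:R `^ (- b)).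
    by rewrite (le_trans h1)// ler_pdivlMl.
  move: IH h1; rewrite !mulrBr; lra.
by rewrite lerD2l ler_pM2l ?invr_gt0// gerBl powR_ge0.
Qed.

Lemma radius_ge_diam_powR (rho delta : nat -> R) (kappa : R) :
  rho @ \oo --> 0 -> (fun n => ln (rho n) / ln (delta n)) @ \oo --> (1 : R) ->
  (forall n, 0 < delta n) -> 1 < kappa ->
  \forall n \near \oo, [/\ 0 < rho n, rho n < 1 & rho n `^ kappa <= delta n].
Proof.
move=> rho0 ratio d0 k1; have k0 : 0 < kappa by exact: lt_trans k1.
have F1 : \forall n \near \oo, rho n < 1 by apply: cvgr_lt rho0 _ ltr01.
have F2 : \forall n \near \oo, kappa^-1 < ln (rho n) / ln (delta n).
  by apply: cvgr_gt ratio _ _; rewrite invf_lt1.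
apply: filterS2 F1 F2 => n r1 rk.
(* At a nonpositive argument [ln] takes the value 0, which would make the ratio 0. *)
have r0 : 0 < rho n.
  rewrite ltNge; apply/negP => rn; move: rk.
  by rewrite ln0// mul0r ltNge invr_ge0 ltW.
split => //.
have lr : ln (rho n) < 0 by rewrite ln_lt0// r0.
have ld : ln (delta n) < 0.
  rewrite ltNge; apply/negP => ld; move: rk; apply/negP; rewrite -leNgt.
  by rewrite (@le_trans _ _ 0) ?invr_ge0 ?(ltW k0)// mulr_le0_ge0 ?invr_ge0// ltW.
rewrite /powR gt_eqF// -[leRHS]lnK ?posrE// ler_expR.
by move: rk; rewrite ltr_ndivlMr// ltr_pdivlMl// => /ltW.
Qed.

(** By divergence, [n.+1 * rho n ^ s2 >= 1] for arbitrarily late [n]. As the diameters decrease, all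
    indices from [i0] to such an [n] have radius at least [rho n ^ kappa], which is about [1 / Q],
    and there are enough of them. *)
Lemma large_blocks (rho delta : nat -> R) (s s1 : R) :
  nonincreasing_seq rho -> rho @ \oo --> 0 ->
  (fun n => ln (rho n) / ln (delta n)) @ \oo --> (1 : R) ->
  (forall n, 0 < delta n) -> 0 < s < s1 ->
  ~ (\sum_(0 <= n <oo) (rho n `^ s1)%:E < +oo)%E ->
  forall n0 Q0 : nat, exists i0 N Q : nat, [/\ (n0 <= i0)%N, (Q0 <= Q)%N,
    (0 < Q)%N, Q%:R `^ s <= N%:R &
    forall j, (j < N)%N -> Q%:R^-1 <= delta (i0 + j)%N].
Proof.
move=> rho_dec rho0 ratio d0 /andP[s0 ss1] dvg n0 Q0.
(* The choice gives [s < kappa * s < s2]; the gap up to [s2] will pay for constants. *)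
pose s2 := (s + s1) / 2; pose kappa := (s + s2) / (2 * s).
have ss2 : s < s2 by rewrite /s2; lra.
have s2s1 : s2 < s1 by rewrite /s2; lra.
have ks : kappa * s = (s + s2) / 2 by rewrite /kappa; field; rewrite gt_eqF.
have k1 : 1 < kappa by rewrite /kappa ltr_pdivlMr ?mulr_gt0//; lra.
have k0 : 0 < kappa by lra.
have [i1 _ i1P] := radius_ge_diam_powR _ _ _ rho0 ratio d0 k1.
pose i0 := maxn n0 i1.
have i0P i : (i0 <= i)%N -> [/\ 0 < rho i, rho i < 1 & rho i `^ kappa <= delta i].
  by move=> h; apply: i1P => /=; move: h; rewrite /i0; lia.
(* Otherwise the terms with exponent [s1] would be dominated by [n.+1 ^ (- (s1 / s2))], which is
   summable. *)
have often m : exists2 n, (m <= n)%N & 1 <= n.+1%:R * rho n `^ s2.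
  apply: contrapT => /forall2NP nm; apply: dvg.
  have s20 : 0 < s2 by lra.
  apply: (@dominated_zeta_series _ (s1 / s2 - 1) (maxn m i0)).
  - by rewrite subr_gt0 ltr_pdivlMr// mul1r.
  - by move=> n; exact: powR_ge0.
  - move=> n; rewrite geq_max => /andP[mn i0n].
    have [/negP|/negP] := nm n; first by rewrite mn.
    rewrite -ltNge => h; rewrite addrC subrK.
    have e0 : 0 <= s1 / s2 by rewrite divr_ge0//; lra.
    have {1}-> : s1 = s2 * (s1 / s2) by rewrite mulrCA divff ?mulr1// gt_eqF.
    rewrite powRrM -mulN1r [leRHS]powRrM powR_inv1//.
    by apply: ge0_ler_powR; rewrite ?nnegrE ?powR_ge0 ?invr_ge0// -[leRHS]mulr1 ler_pdivlMl ?ltr0n// ltW.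
pose beta := s2 - kappa * s.
have b0 : 0 < beta by rewrite /beta ks; lra.
(* [A] collects the losses: [2 ^ s] from rounding [Q] up, and the [i0] indices that are skipped. *)
pose A : R := 2 `^ s + i0%:R.
have A0 : 0 < A by rewrite ltr_wpDr// powR_gt0.
have [m _ mP] : \forall n \near \oo, rho n < Num.min (A^-1 `^ beta^-1) (Q0.+1%:R^-1).
  by apply: cvgr_lt rho0 _ _; rewrite lt_min powR_gt0 ?invr_gt0//= ltr0n.
have [n mn n_often] := often (maxn m i0).
have {mn} [mn i0n] : (m <= n)%N /\ (i0 <= n)%N by move: mn; rewrite geq_max => /andP.
have [r0 r1 rd] := i0P n i0n.
have := mP n mn; rewrite lt_min => /andP[rA rQ].
have r'0 : 0 < rho n `^ kappa by exact: powR_gt0.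
have /andP[Qlo Qhi] := @truncn_itv R (rho n `^ kappa)^-1 (ltac:(by rewrite invr_ge0 ltW)).
pose Q := (Num.truncn (rho n `^ kappa)^-1).+1.
exists i0, (n.+1 - i0)%N, Q; split => //.
- by rewrite leq_maxl.
- rewrite -(ler_nat R) (le_trans _ (ltW Qhi))//.
  have h : rho n `^ kappa <= Q0.+1%:R^-1.
    apply: le_trans (ltW rQ); apply: ge1r_powR; last exact: ltW.
    by rewrite r0 ltW.
  apply: (@le_trans _ _ Q0.+1%:R); first by rewrite ler_nat.
  by rewrite -[leLHS]invrK lef_pV2 ?posrE ?invr_gt0 ?ltr0n.
- have Q2 : Q%:R <= 2 * (rho n `^ kappa)^-1.
    have : 1 <= (rho n `^ kappa)^-1.
      by rewrite -powRN -[leLHS](powRr0 (rho n)) ger_powR ?r0 ?(ltW r1)// oppr_le0 ltW.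
    move: Qlo; rewrite /Q -natr1; lra.
  pose p := rho n `^ (- (kappa * s)).
  have p0 : 0 < p by exact: powR_gt0.
  have p1 : 1 <= p.
    rewrite /p -[leLHS](powRr0 (rho n)) ger_powR ?r0 ?(ltW r1)// oppr_le0.
    by rewrite mulr_ge0// ltW.
  have Qs : Q%:R `^ s <= 2 `^ s * p.
    have -> : 2 `^ s * p = (2 * (rho n `^ kappa)^-1) `^ s.
      by rewrite powRM ?invr_ge0 ?powR_ge0// -powRN -powRrM mulNr.
    by apply: ge0_ler_powR; rewrite ?nnegrE ?mulr_ge0 ?invr_ge0 ?powR_ge0// ltW.
  have pA : p * A <= n.+1%:R.
    have h : A <= rho n `^ (- beta).
      rewrite powRN -[leLHS]invrK lef_pV2 ?posrE ?invr_gt0 ?powR_gt0//.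
      rewrite -[leRHS]powRr1 ?invr_ge0 ?(ltW A0)// -[X in _ <= _ `^ X](@mulVf _ beta) ?gt_eqF// powRrM.
      by apply: ge0_ler_powR; rewrite ?nnegrE ?powR_ge0 ?(ltW r0) ?(ltW b0) ?(ltW rA).
    rewrite (le_trans (ler_wpM2l (ltW p0) h))// /p -powRD; last by rewrite (gt_eqF r0) implybT.
    rewrite (_ : _ + _ = - s2); last by rewrite /beta; ring.
    by rewrite powRN -[leLHS]mul1r ler_pdivrMr ?powR_gt0.
  have i0p : i0%:R <= p * i0%:R by rewrite ler_peMl.
  rewrite (le_trans Qs)// natrB; last exact: leqW.
  move: pA; rewrite /A mulrDr; lra.
- move=> j jN; have [_ _ h] := i0P (i0 + j)%N (leq_addr _ _).
  rewrite (le_trans _ h)//.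
  rewrite (@le_trans _ _ (rho n `^ kappa))//.
    by rewrite -[leRHS]invrK lef_pV2 ?posrE ?invr_gt0 ?ltr0n// ltW.
  apply: ge0_ler_powR; rewrite ?nnegrE ?(ltW k0) ?(ltW r0)//.
    by have [/ltW] := i0P (i0 + j)%N (leq_addr _ _).
  by apply: rho_dec; move: jN; rewrite ltn_subRL ltnS.
Qed.

End blocks.

(** * Good blocks *)

(* The last two clauses say that a block has few points in each tube, and that
   its scale is small enough for these few points to be negligible. *)
Definition good_block {R : realType} {d} (p : nat -> 'rV[R]_d) (delta : nat -> R)
    (k : nat) (t K : R) (q n0 : nat) : Prop :=
  exists (i0 N q' : nat) (M : R), [/\ [/\ (n0 <= i0)%N, (3 * q <= q')%N & (0 < N)%N],
    forall j, (j < N)%N -> d%:R / q'%:R < delta (i0 + j)%N,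
    forall z : {ffun 'I_d -> 'I_(3 * q).-1.+1}, N%:R / ((3 * q) ^ d)%:R / 4 <=
      #|[pred j : 'I_N | cell (3 * q).-1 (p (i0 + j)%N) == z]|%:R :> R,
    forall q1 (V : 'M[R]_d) (S : {set 'I_N}), (q <= q1 <= q')%N -> \rank V = k ->
      (forall j l, j \in S -> l \in S ->
        (forall v, (v <= V)%MS -> (forall i, `|v 0 i| <= 1) ->
         `|dotp v (p (i0 + j)%N - p (i0 + l)%N)| <= (3 * d)%:R / q1%:R) /\
        (forall i, `|p (i0 + j)%N 0 i - p (i0 + l)%N 0 i| <= q%:R^-1)) ->
      #|S|%:R <= K * q%:R ^+ k * N%:R / (q1%:R ^+ k * q%:R ^+ d) + M &
    0 <= M /\ (K * q%:R ^+ k * N%:R / (q'%:R ^+ k * q%:R ^+ d) + M) * q'%:R `^ t <=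
      N%:R / (8 * 3 ^+ d * q%:R ^+ d)].

Section good_blocks.
Context (disp : measure_display) (Omega : measurableType disp) (R : realType).
Context (P : probability Omega R) (d : nat).
Context (xi : nat -> {RV P >-> borel_rV R d}) (x : nat -> 'rV[R]_d).
Hypothesis xi_unif : forall n, uniform_on_torus (xi n).
Hypothesis xi_indep : mutually_independent xi.
Hypothesis xT : forall n, torus R d (x n).
Local Notation c := (translate_center xi x).
Context (rho delta : nat -> R) (k : nat) (t s1 : R).
Hypothesis d0 : (0 < d)%N.
Hypothesis rho_dec : nonincreasing_seq rho.
Hypothesis rho0 : rho @ \oo --> 0.
Hypothesis ratio : (fun n => ln (rho n) / ln (delta n)) @ \oo --> (1 : R).
Hypothesis delta0 : forall n, 0 < delta n.
Hypothesis dvg : ~ (\sum_(0 <= n <oo) (rho n `^ s1)%:E < +oo)%E.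
Hypothesis t0 : 0 <= t.
Hypothesis ts1 : t < s1.
Hypothesis tk : t < k%:R.

(** The constant of [crowded_tube_event] for [D = 3 * d]; the 3 counts the two passages between a
    center and a point of its cell and the width of the tube itself. *)
Definition crowding_const : R := 3 * (10 * (3 * d + 2 * d) + 10)%:R ^+ d.

Lemma good_block_event q n0 eta : (0 < q)%N -> 0 < eta ->
  exists B, [/\ measurable B, (P B <= eta%:E)%E &
    forall w, ~ B w -> good_block (c ^~ w) delta k t crowding_const q n0].
Proof.
move=> q0 eta0; pose s := (t + s1) / 2; pose eps := (s1 - t) / 4.
have s0 : 0 < s < s1 by apply/andP; move: t0 ts1; rewrite /s; split; lra.
have eps0 : 0 < eps by move: ts1; rewrite /eps; lra.
have tes : t + eps < s by move: ts1; rewrite /s /eps; lra.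
have K0 : 0 <= crowding_const by rewrite mulr_ge0// exprn_ge0.
have [Q0 _ cond] := scale_conditions d q k s t eps _ eta d0 q0 eps0 t0 tes tk K0 eta0.
have [i0 [N [Q [n0i Q0Q Qpos QN Qdelta]]]] :=
  large_blocks rho delta s s1 rho_dec rho0 ratio delta0 s0 dvg n0 Q0.
have [] := cond Q Q0Q N QN; set q' := (2 * d * Q)%N; set M := Q%:R `^ eps.
move=> q'3 cM cP.
have M0 : 0 <= M by exact: powR_ge0.
have [Ba [mBa PBa Ba_good]] := empty_cell_event _ _ _ P d xi x xi_unif xi_indep xT (3 * q).-1 i0 N.
pose e : R := (2 ^ d * (2 * q').+1 ^ (d * d) * q' ^ d)%:R * expR (- M).
have /choice[Bt Bt_P] : forall r : 'I_q', exists B, [/\ measurable B, (P B <= e%:E)%E &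
    (q <= r.+1)%N -> forall w, ~ B w -> forall (V : 'M[R]_d) (S : {set 'I_N}),
      (forall j l, j \in S -> l \in S ->
        (forall v, (v <= V)%MS -> (forall i, `|v 0 i| <= 1) ->
         `|dotp v (c (i0 + j)%N w - c (i0 + l)%N w)| <= (3 * d)%:R / r.+1%:R) /\
        (forall i, `|c (i0 + j)%N w 0 i - c (i0 + l)%N w 0 i| <= q%:R^-1)) ->
      #|S|%:R <= crowding_const * q%:R ^+ (\rank V)
                 * N%:R / (r.+1%:R ^+ (\rank V) * q%:R ^+ d) + M].
  (* The width is [1 / r.+1]; nothing is asked of widths above [1 / q]. *)
  move=> r; have [qr|qr] := leqP q r.+1; last first.
    by exists set0; rewrite measure0 lee_fin mulr_ge0 ?expR_ge0.
  have h : (0 < q <= r.+1)%N by rewrite q0.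
  have [B [mB PB goodB]] := crowded_tube_event _ _ _ P d xi x xi_unif xi_indep xT r i0 N q (3 * d) M M0 h.
  exists B; split => //; rewrite (le_trans PB)// lee_fin ler_wpM2r ?expR_ge0//.
  by rewrite ler_nat !leq_mul// leq_exp2r// ?muln_gt0 ?d0// ?ltnS ?leq_mul2l ?ltn_ord ?orbT.
have mBt r : measurable (Bt r) by have [] := Bt_P r.
have [mU PU] := measure_finite_subadditive _ _ _ P _ predT Bt mBt.
exists (Ba `|` \bigcup_(r in [set` predT]) Bt r); split.
- exact: measurableU.
- apply: (le_trans (measureU2 _ mBa mU)); move: cP; rewrite -lee_fin.
  apply: le_trans; rewrite EFinD leeD//.
    by move: PBa; rewrite prednK ?muln_gt0.
  have PBt r : true -> (P (Bt r) <= e%:E)%E by have [] := Bt_P r.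
  rewrite (le_trans PU)// (le_trans (lee_sum _ PBt))//.
  by rewrite sumEFin lee_fin sumr_const card_ord -[leLHS]mulr_natl mulrA.
move=> w /not_orP[wBa wBt].
have N0 : (0 < N)%N.
  by rewrite -(ltr0n R) (lt_le_trans _ QN)// ?powR_gt0 ?ltr0n.
exists i0, N, q', M; split => //.
(* By the choice of [q'], [d / q'] is half of [1 / Q]. *)
- move=> j jN; apply: lt_le_trans (Qdelta _ jN).
  have QR : 0 < Q%:R :> R by rewrite ltr0n.
  have dR : 0 < d%:R :> R by rewrite ltr0n.
  rewrite /q' natrM natrM ltr_pdivrMr ?mulr_gt0// mulrCA mulVf ?gt_eqF// mulr1.
  by rewrite ltr_pMl// ltr1n.
- move=> z; have := Ba_good w wBa z; by rewrite (_ : ((3 * q).-1.+1 ^ d = (3 * q) ^ d)%N)// prednK ?muln_gt0.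
- move=> q1 V S /andP[qq1 q1q'] <- SV.
  have q1E : q1 = q1.-1.+1 by rewrite prednK// (leq_trans q0).
  have q1o : (q1.-1 < q')%N by rewrite -q1E.
  have [_ _ h] := Bt_P (Ordinal q1o).
  have := h _ w _ V S; rewrite /= -q1E; apply => //.
  by move=> wB; apply: wBt; exists (Ordinal q1o).
Qed.

(** For fixed [q] and [n0] the failure lies in events of arbitrarily small probability, hence in a
    null set; there are countably many pairs. *)
Lemma ae_good_block : {ae P, forall w, forall q n0, (0 < q)%N ->
  good_block (c ^~ w) delta k t crowding_const q n0}.
Proof.
have H (qn : nat * nat) : exists B, [/\ measurable B, P B = 0 &
    forall w, ~ B w -> good_block (c ^~ w) delta k t crowding_const qn.1.+1 qn.2].
  have /choice[B BP] : forall l : nat, exists B, [/\ measurable B,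
      (P B <= (l.+1%:R^-1)%:E)%E & forall w, ~ B w ->
      good_block (c ^~ w) delta k t crowding_const qn.1.+1 qn.2].
    by move=> l; apply: good_block_event; rewrite ?invr_gt0.
  have mB : measurable (\bigcap_l B l).
    by apply: bigcapT_measurable => l; have [] := BP l.
  exists (\bigcap_l B l); split => //.
    apply/eqP; rewrite eq_le measure_ge0 andbT; apply/lee_addgt0Pr => e e0.
    rewrite add0e; pose l := Num.truncn e^-1.
    have [mBl PBl _] := BP l.
    rewrite (@le_trans _ _ (P (B l)))//.
      by apply: le_measure; rewrite ?inE//; exact: bigcap_inf.
    rewrite (le_trans PBl)// lee_fin -[leRHS]invrK lef_pV2 ?posrE ?invr_gt0// ltW//.
    by have /truncn_itv/andP[] : 0 <= e^-1 by rewrite invr_ge0 ltW.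
  move=> w wB; have [l wBl] : exists l, ~ B l w.
    by apply/existsNP => h; apply: wB => l _; exact: h.
  by have [_ _] := BP l; apply.
have /choice[B BP] := H.
have : P.-negligible (\bigcup_q \bigcup_n B (q, n)).
  apply: negligible_bigcup => q; apply: negligible_bigcup => n.
  by have [mB PB _] := BP (q, n); apply/negligibleP.
apply: negligibleS => w /= wbad; apply: contrapT => wB; apply: wbad => q n0 q0.
have [_ _ /(_ w)] := BP (q.-1, n0); rewrite /= prednK//; apply => wBq.
by apply: wB; exists q.-1 => //; exists n0.
Qed.

End good_blocks.

(** * The Cantor construction *)

Section cantor_construction.
Context {R : realType} {d k : nat} (t K : R).
Context (p : nat -> 'rV[R]_d) (delta : nat -> R) (V : 'M[R]_d).
Context (U : nat -> set 'rV[R]_d) (u : nat -> R).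
Hypothesis pT : forall n, torus R d (p n).
Hypothesis t0 : 0 <= t.
Hypothesis tk : t < k%:R.
Hypothesis K0 : 0 <= K.
Hypothesis good : forall q n0, (0 < q)%N -> good_block p delta k t K q n0.
Hypothesis rV : \rank V = k.
Hypothesis u0 : forall i, 0 < u i.
Hypothesis uU : forall i a b, U i a -> U i b -> eucl_dist a b <= u i.

Definition in_cell (q : nat) (z : 'I_d -> nat) (y : 'rV[R]_d) : Prop :=
  forall i, (z i)%:R <= q%:R * y 0 i < (z i)%:R + 1.

Definition hit q z i : bool := `[< exists y, in_cell q z y /\ U i (orth_proj V y) >].

Definition hit_cost q z : \bar R :=
  (\sum_(0 <= i <oo) (if hit q z i then u i `^ t else 0)%:E)%E.

(** Chosen so that in [cantor_step] the contribution of [K] is at most a quarter of the guaranteed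
    number of centers. *)
Definition cost_const : R := (16 * 3 ^+ d * 2 ^+ k * (K + 1))^-1.

Definition cheap (q : nat) z : Prop :=
  (hit_cost q z < (cost_const / q%:R `^ t)%:E)%E.

Lemma cost_const_gt0 : 0 < cost_const.
Proof. by rewrite invr_gt0 !mulr_gt0 ?exprn_gt0// ltr_wpDl. Qed.

Lemma cost_const_le1 : cost_const <= 1.
Proof.
rewrite invf_le1; last by rewrite -invr_gt0 cost_const_gt0.
have h3 : 1 <= 3 ^+ d :> R by rewrite exprn_ege1// ler1n.
have h2 : 1 <= 2 ^+ k :> R by rewrite exprn_ege1// ler1n.
by rewrite !mulr_ege1// ?ler1n// lerDr.
Qed.

Lemma in_cellP q z y : (0 < q)%N ->
  in_cell q z y <-> forall i, (z i)%:R / q%:R <= y 0 i < ((z i)%:R + 1) / q%:R.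
Proof.
rewrite -(ltr0n R) => q0.
by split => h i; have := h i; rewrite ler_pdivrMr// ltr_pdivlMr// [q%:R * _]mulrC.
Qed.

Let in_cell_cell r n : in_cell r.+1 (fun i => cell r (p n) i) (p n).
Proof. by move=> i; exact: cellP. Qed.

Lemma cheap_hit_lt q z i : (0 < q)%N -> cheap q z -> hit q z i ->
  u i `^ t * q%:R `^ t < 1.
Proof.
move=> q0 zc hi; have qt : 0 < q%:R `^ t by rewrite powR_gt0// ltr0n.
rewrite -ltr_pdivlMr// mul1r -lte_fin.
have h : ((u i `^ t)%:E <= hit_cost q z)%E.
  rewrite /hit_cost (nneseriesD1 (n := i))//=; last first.
    by move=> j _; rewrite lee_fin; case: ifP => // _; exact: powR_ge0.
  rewrite hi leeDl// nneseries_ge0// => j _ _.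
  by rewrite lee_fin; case: ifP => // _; exact: powR_ge0.
apply: (le_lt_trans h); apply: (lt_le_trans zc).
by rewrite lee_fin ler_pdivrMr// mulVf ?gt_eqF// cost_const_le1.
Qed.

(** A tube of width at least [1 / q] would alone exceed the budget of a cheap cell. *)
Lemma lt_hit_inv q z i : (0 < q)%N -> cheap q z -> hit q z i -> u i < q%:R^-1.
Proof.
move=> q0 zc hi; have qR : 0 < q%:R :> R by rewrite ltr0n.
have := cheap_hit_lt q z i q0 zc hi.
rewrite -powRM ?(ltW (u0 i)) ?(ltW qR)// => h; rewrite -[ltRHS]mul1r ltr_pdivlMr//.
rewrite ltNge; apply/negP => h1; move: h; rewrite ltNge => /negP; apply.
have e1 : 1 `^ t = 1 :> R by rewrite powR1.
by rewrite -[leLHS]e1 ge0_ler_powR ?nnegrE ?mulr_ge0 ?(ltW qR) ?(ltW (u0 i)).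
Qed.

Section step.
Variables (q n0 : nat) (z : 'I_d -> nat).
Hypothesis q0 : (0 < q)%N.
Hypothesis zq : forall i, (z i < q)%N.
Hypothesis zc : cheap q z.

(** Averaging over the centers of a good block: the tubes meeting the cell are too light to spoil
    the cells around all these centers. *)
Lemma cantor_step : exists n q' z', [/\ (n0 <= n)%N, (3 * q <= q')%N,
  forall i, (z' i < q')%N, cheap q' z' &
  (forall y, in_cell q' z' y -> eucl_dist y (p n) < delta n) /\
  forall i, (z i)%:R / q%:R <= (z' i)%:R / q'%:R :> R /\
            ((z' i)%:R + 1) / q'%:R < ((z i)%:R + 1) / q%:R :> R].
Proof.
have [i0 [N [q' [M [[n0i q3 N0] dq Dcount Scount [M0 final]]]]]] := good q n0 q0.
have q'0 : (0 < q')%N by rewrite (leq_trans _ q3)// muln_gt0.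
have qR : 0 < q%:R :> R by rewrite ltr0n.
have q'R : 0 < q'%:R :> R by rewrite ltr0n.
have q'E : q' = q'.-1.+1 by rewrite prednK.
have q3E : (3 * q = (3 * q).-1.+1)%N by rewrite prednK// muln_gt0.
(* Only centers in the middle one of the [3 ^ d] subcells are used. Since [q' >= 3 * q], the cells
   around them stay inside the given one, with a strict inequality at the upper faces. *)
have zm i : (3 * z i + 1 < (3 * q).-1.+1)%N.
  rewrite -q3E; apply: (@leq_trans (3 * (z i).+1)%N); last by rewrite leq_mul2l zq.
  by rewrite mulnS addnC ltn_add2r.
pose mid : {ffun 'I_d -> 'I_(3 * q).-1.+1} := [ffun i => Ordinal (zm i)].
pose D : {set 'I_N} := [set j : 'I_N | cell (3 * q).-1 (p (i0 + j)%N) == mid]%SET.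
pose child (j : 'I_N) (i : 'I_d) : nat := cell q'.-1 (p (i0 + j)%N) i.
have childP j : in_cell q' (child j) (p (i0 + j)%N) by rewrite [X in in_cell X]q'E; exact: in_cell_cell.
have midP j i : j \in D ->
    ((3 * z i)%:R + 1) / (3 * q)%:R <= p (i0 + j)%N 0 i < ((3 * z i)%:R + 2) / (3 * q)%:R.
  rewrite inE => /eqP jm; have := in_cell_cell (3 * q).-1 (i0 + j)%N i.
  rewrite jm ffunE/= -q3E natrD => /andP[h1 h2].
  have q3R : 0 < (3 * q)%:R :> R by rewrite ltr0n muln_gt0.
  by rewrite ler_pdivrMr// ltr_pdivlMr//; apply/andP; split; lra.
have nested j i : j \in D -> (z i)%:R / q%:R <= (child j i)%:R / q'%:R :> R /\
    ((child j i)%:R + 1) / q'%:R < ((z i)%:R + 1) / q%:R :> R.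
  move=> jD; have /andP[b1 b2] := childP j i; have /andP[c1 c2] := midP j i jD.
  move: c1 c2; rewrite !natrM ler_pdivrMr ?mulr_gt0// ltr_pdivlMr ?mulr_gt0//.
  move: b1 b2.
  have q3R : 3 * q%:R <= q'%:R :> R by rewrite -natrM ler_nat.
  move: (p _ 0 i) (child j i)%:R (z i)%:R => x ch a b1 b2 c1 c2.
  have e1 : q%:R * ch <= q%:R * (q'%:R * x) by rewrite ler_pM2l.
  have e2 : q%:R * (q'%:R * x) < q%:R * (ch + 1) by rewrite ltr_pM2l.
  have e3 : q'%:R * (3 * a + 1) <= q'%:R * (x * (3 * q%:R)) by rewrite ler_pM2l.
  have e4 : q'%:R * (x * (3 * q%:R)) < q'%:R * (3 * a + 2) by rewrite ltr_pM2l.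
  rewrite ler_pdivrMr// mulrAC ler_pdivlMr// ltr_pdivrMr// mulrAC ltr_pdivlMr//.
  by split; lra.
have close j y : in_cell q' (child j) y -> forall i, `|y 0 i - p (i0 + j)%N 0 i| <= q'%:R^-1.
  move=> yc i; have /andP[a1 a2] := yc i; have /andP[b1 b2] := childP j i.
  rewrite -[leRHS]div1r ler_pdivlMr// -[X in _ * X](ger0_norm (ltW q'R)) -normrM.
  by rewrite ler_norml; apply/andP; split; lra.
suff [j jD jc] : exists2 j, j \in D & cheap q' (child j).
  exists (i0 + j)%N, q', (child j); split => //.
  - by rewrite (leq_trans n0i)// leq_addr.
  - by move=> i; rewrite q'E; exact: ltn_ord.
  - split; last by move=> i; exact: nested.
    move=> y yc; apply: le_lt_trans (dq j (ltn_ord j)).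
    apply: eucl_norm_le_sup; first by rewrite invr_ge0.
    by move=> i; rewrite !mxE; exact: close.
have hit_parent j i : j \in D -> hit q' (child j) i -> hit q z i.
  move=> jD /asboolP[y [yc Uy]]; apply/asboolP; exists y; split => //.
  apply/in_cellP => // l; have /in_cellP/(_ l)/andP[//|h1 h2] := yc.
  have [n1 n2] := nested j l jD.
  by rewrite (le_trans n1 h1) (lt_trans h2 n2).
pose M' := K * q%:R ^+ k * N%:R / (q'%:R ^+ k * q%:R ^+ d) + M.
(* A center whose tubes have total weight below 1 meets no tube of width at
   least [1/q'], and its cell is cheap. *)
pose w i : R := if q'%:R^-1 <= u i then 1 else u i `^ t * q'%:R `^ t / cost_const.
(* The first term bounds the expected number of centers in wide tubes; the second covers the excess
   [M] and all narrow tubes. *)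
pose Lam : R := K * 2 ^+ k * N%:R * q%:R `^ t / q%:R ^+ d + M' * q'%:R `^ t / cost_const.
have w0 i : 0 <= w i.
  by rewrite /w; case: ifP => // _; rewrite !mulr_ge0 ?powR_ge0// invr_ge0 ltW// cost_const_gt0.
have M'0 : 0 <= M'.
  by rewrite addr_ge0// !mulr_ge0 ?invr_ge0 ?mulr_ge0 ?exprn_ge0.
have c0 := cost_const_gt0; have c1 := cost_const_le1.
have Lam0 : 0 <= Lam.
  apply: addr_ge0; last by rewrite divr_ge0 ?mulr_ge0 ?powR_ge0// ltW.
  by rewrite !mulr_ge0 ?invr_ge0 ?powR_ge0 ?exprn_ge0// ltW.
have count i : hit q z i ->
    #|[set j in D | hit q' (child j) i]%SET|%:R * w i <= Lam * u i `^ t.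
  move=> hi; have ui := lt_hit_inv q z i q0 zc hi.
  set H := [set j in D | hit q' (child j) i]%SET.
  (* Two centers whose cells meet one tube are compared through points [y] and [y'] of the cells
     that project into [U i]; each of the three differences contributes [d / q1]. *)
  have cardH q1 : (q <= q1 <= q')%N -> u i <= q1%:R^-1 ->
      #|H|%:R <= K * q%:R ^+ k * N%:R / (q1%:R ^+ k * q%:R ^+ d) + M.
    move=> q1q uq1; apply: (Scount q1 V H q1q rV) => j l.
    have q1R : 0 < q1%:R :> R by rewrite ltr0n (leq_trans q0)//; case/andP: q1q.
    have q'q1 : q'%:R^-1 <= q1%:R^-1 :> R.
      by rewrite lef_pV2 ?posrE// ler_nat; case/andP: q1q.
    rewrite !inE => /andP[jD /asboolP[y [yc Uy]]] /andP[lD /asboolP[y' [y'c Uy']]].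
    have jmid : j \in D by rewrite inE.
    have lmid : l \in D by rewrite inE.
    split=> [v vV v1|a]; last first.
      have /andP[a1 a2] := midP j a jmid; have /andP[b1 b2] := midP l a lmid.
      rewrite -[leRHS]div1r ler_pdivlMr// -[X in _ * X](ger0_norm (ltW qR)) -normrM.
      move: a1 a2 b1 b2; rewrite !natrM !ler_pdivrMr ?mulr_gt0// !ltr_pdivlMr ?mulr_gt0//.
      by move=> *; rewrite ler_norml; apply/andP; split; lra.
    rewrite (_ : p (i0 + j)%N - p (i0 + l)%N =
      (p (i0 + j)%N - y) + ((y - y') + (y' - p (i0 + l)%N))); last by rewrite !addrA !subrK.
    rewrite dotpDr (dotpDr _ _ (y - y')) natrM -mulrA.
    have -> : 3 * (d%:R / q1%:R) = d%:R / q1%:R + (d%:R / q1%:R + d%:R / q1%:R) :> R by lra.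
    rewrite (le_trans (ler_normD _ _))// lerD//.
      apply: norm_dotp_le => // a; rewrite !mxE distrC (le_trans _ q'q1)//; exact: close.
    rewrite (le_trans (ler_normD _ _))// lerD//.
      rewrite (dotp_orth_proj _ _ _ _ _ vV) orth_projB; apply: norm_dotp_le => // a.
      apply: le_trans uq1; apply: (le_trans (coord_le_eucl_norm _ _ _ a)); exact: uU Uy Uy'.
    apply: norm_dotp_le => // a; rewrite !mxE (le_trans _ q'q1)//; exact: close.
  have ut0 : 0 <= u i `^ t by exact: powR_ge0.
  have q't0 : 0 <= q'%:R `^ t by exact: powR_ge0.
  have u0i := u0 i.
  rewrite /w; case: ifP => big.
    (* For a wide tube [1 / q1] is its width up to a factor 2, and [q1] lies between [q] and
       [q']. *)
    pose q1 := Num.truncn (u i)^-1.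
    have /andP[q1lo q1hi] : q1%:R <= (u i)^-1 < q1.+1%:R.
      by apply: truncn_itv; rewrite invr_ge0 ltW.
    have qq1 : (q <= q1)%N.
      rewrite -ltnS -(ltr_nat R) (le_lt_trans _ q1hi)//.
      by rewrite -[leLHS]invrK lef_pV2 ?posrE ?invr_gt0// ltW.
    have q1q' : (q1 <= q')%N.
      rewrite -(ler_nat R) (le_trans q1lo)//.
      by rewrite -[leRHS]invrK lef_pV2 ?posrE ?invr_gt0.
    have q1R : 0 < q1%:R :> R by rewrite ltr0n (leq_trans q0).
    have q1q : (q <= q1 <= q')%N by rewrite qq1.
    have uq1 : u i <= q1%:R^-1.
      by rewrite -[leLHS]invrK lef_pV2 ?posrE ?invr_gt0.
    rewrite mulr1; apply: (le_trans (cardH q1 q1q uq1)).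
    have q1u : q1%:R^-1 <= 2 * u i.
      rewrite -[leRHS]invrK lef_pV2 ?posrE ?invr_gt0 ?mulr_gt0// invfM.
      have : 1 <= q1%:R :> R by rewrite ler1n (leq_trans q0).
      by move: q1hi; rewrite -natr1; lra.
    (* The exponent may drop from [k] to [t] because [q * u i < 1]. *)
    have quk : (q%:R * u i) ^+ k <= q%:R `^ t * u i `^ t.
      rewrite -powRM ?(ltW qR) ?(ltW u0i)// -powR_mulrn; last by rewrite mulr_ge0// ltW.
      rewrite ger_powR ?(ltW tk)// mulr_gt0//= -ler_pdivlMl// mulr1; exact: ltW.
    rewrite /Lam mulrDl lerD//.
      have -> : K * q%:R ^+ k * N%:R / (q1%:R ^+ k * q%:R ^+ d) =
          K * N%:R / q%:R ^+ d * (q%:R * q1%:R^-1) ^+ k.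
        rewrite exprMn exprVn; field; rewrite !expf_neq0 ?gt_eqF//.
      have -> : K * 2 ^+ k * N%:R * q%:R `^ t / q%:R ^+ d * u i `^ t =
          K * N%:R / q%:R ^+ d * (2 ^+ k * (q%:R `^ t * u i `^ t)) by ring.
      rewrite ler_wpM2l ?mulr_ge0 ?invr_ge0 ?exprn_ge0 ?(ltW qR)//.
      apply: le_trans (ler_wpM2l _ quk); last by rewrite exprn_ge0.
      rewrite -exprMn lerXn2r ?nnegrE ?mulr_ge0 ?invr_ge0 ?(ltW qR) ?(ltW q1R) ?(ltW u0i)//.
      by rewrite mulrCA ler_wpM2l// ltW.
    apply: (@le_trans _ _ M'); first by rewrite lerDr !mulr_ge0 ?invr_ge0 ?mulr_ge0 ?exprn_ge0.
    have qu1 : 1 <= q'%:R `^ t * u i `^ t.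
      rewrite -powRM ?(ltW q'R) ?(ltW u0i)//.
      have e1 : 1 `^ t = 1 :> R by rewrite powR1.
      rewrite -[leLHS]e1; apply: ge0_ler_powR; rewrite ?nnegrE ?mulr_ge0 ?(ltW q'R) ?(ltW u0i)//.
      by rewrite mulrC -ler_pdivrMr// div1r.
    have -> : M' * q'%:R `^ t / cost_const * u i `^ t =
      M' * ((q'%:R `^ t * u i `^ t) / cost_const) by ring.
    by rewrite ler_peMr// ler_pdivlMr// mul1r (le_trans c1).
  have uq' : u i <= q'%:R^-1 by rewrite leNgt; apply/negP => /ltW; rewrite big.
  have := cardH q'; rewrite leqnn andbT (leq_trans _ q3) ?leq_pmull// => /(_ isT uq').
  rewrite -/M' => cH.
  apply: (le_trans (ler_wpM2r _ cH)); first by rewrite divr_ge0 ?mulr_ge0// ltW.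
  have -> : M' * (u i `^ t * q'%:R `^ t / cost_const) =
      M' * q'%:R `^ t / cost_const * u i `^ t by ring.
  rewrite ler_wpM2r// lerDr !mulr_ge0 ?invr_ge0 ?exprn_ge0 ?powR_ge0//.
(* With [Y = N / (3 q) ^ d], there are at least [Y / 4] centers, and the two terms of [Lam]
   contribute at most [Y / 16] and [Y / 8]. *)
have LamD : Lam * (cost_const / q%:R `^ t) < #|D|%:R.
  pose Y : R := N%:R / (3 ^+ d * q%:R ^+ d).
  have Y0 : 0 < Y by rewrite divr_gt0 ?mulr_gt0 ?exprn_gt0// ltr0n.
  have qt1 : 1 <= q%:R `^ t.
    by rewrite -[leLHS](powRr0 q%:R) ler_powR// ler1n.
  have D1 : Y / 4 <= #|D|%:R.
    have := Dcount mid; rewrite (eq_card (B := D)); last by move=> j; rewrite !inE.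
    by rewrite natrX natrM exprMn.
  have L1 : M' * q'%:R `^ t / q%:R `^ t <= Y / 8.
    rewrite ler_pdivrMr ?(lt_le_trans ltr01)//; apply: (le_trans final).
    rewrite (_ : N%:R / _ = Y / 8); first by rewrite ler_peMr// ltW// divr_gt0.
    by rewrite /Y; field; rewrite !expf_neq0 ?gt_eqF.
  have L2 : K * 2 ^+ k * cost_const * (N%:R / q%:R ^+ d) <= Y / 16.
    rewrite (_ : Y / 16 = (16 * 3 ^+ d)^-1 * (N%:R / q%:R ^+ d)); last first.
      by rewrite /Y; field; rewrite !expf_neq0 ?gt_eqF.
    rewrite ler_wpM2r ?divr_ge0 ?exprn_ge0 ?(ltW qR)//.
    have K1 : 0 < K + 1 by rewrite ltr_wpDl.
    rewrite (_ : K * _ * _ = (K / (K + 1)) / (16 * 3 ^+ d)); last first.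
      by rewrite /cost_const; field; rewrite !expf_neq0 ?gt_eqF.
    rewrite ler_piMl ?invr_ge0 ?mulr_ge0 ?exprn_ge0//.
    by rewrite ler_pdivrMr// mul1r lerDl.
  have -> : Lam * (cost_const / q%:R `^ t) = K * 2 ^+ k * cost_const * (N%:R / q%:R ^+ d) +
     M' * q'%:R `^ t / q%:R `^ t.
    by rewrite /Lam; field; rewrite !gt_eqF ?exprn_gt0// (lt_le_trans ltr01).
  by move: L1 L2 D1 Y0; lra.
apply: contrapT => nocheap.
(* Either a wide tube, of weight 1, meets the cell, or all its tubes are narrow and their weights
   add up to its cost in units of the budget. *)
have X1 j : j \in D ->
    (1 <= \sum_(0 <= i <oo) (if hit q' (child j) i then w i else 0)%:E)%E.
  move=> jD; have : ~ cheap q' (child j) by move=> h; apply: nocheap; exists j.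
  rewrite /cheap => /negP; rewrite -leNgt => costly.
  have f0 i : (0 <= (if hit q' (child j) i then w i else 0)%:E)%E.
    by rewrite lee_fin; case: ifP.
  have [[i hi ui]|small] :=
      pselect (exists2 i, hit q' (child j) i & q'%:R^-1 <= u i).
    apply: le_trans (nneseries_lim_ge i.+1 (fun i _ _ => f0 i)).
    by rewrite big_nat_recr//= hi /w ui leeDr// sume_ge0.
  apply: (@le_trans _ _ ((q'%:R `^ t / cost_const)%:E * hit_cost q' (child j))%E).
    apply: (@le_trans _ _ ((q'%:R `^ t / cost_const)%:E * (cost_const / q'%:R `^ t)%:E)%E).
      by rewrite -EFinM lee_fin mulrA divfK ?gt_eqF// divff ?gt_eqF ?powR_gt0.
    by rewrite lee_wpmul2l// lee_fin divr_ge0 ?powR_ge0// ltW.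
  rewrite /hit_cost -nneseriesZl; last first.
    by move=> i _; rewrite lee_fin; case: ifP => // _; exact: powR_ge0.
  apply: lee_nneseries => i _.
    by move=> _; rewrite mule_ge0 ?lee_fin ?divr_ge0 ?powR_ge0 ?(ltW c0)//; case: ifP => // _; exact: powR_ge0.
  rewrite -EFinM lee_fin; case: ifP => hi; last by rewrite mulr0.
  rewrite /w ifN; first by rewrite mulrC mulrA.
  by apply/negP => ui; apply: small; exists i.
(* Double counting of the pairs of a center and a tube meeting its cell. *)
have : (#|D|%:R%:E <= (Lam * (cost_const / q%:R `^ t))%:E :> \bar R)%E.
  apply: (@le_trans _ _ (\sum_(j in D) \sum_(0 <= i <oo) (if hit q' (child j) i then w i else 0)%:E)%E).
    rewrite -sum1_card natr_sum -sumEFin; apply: lee_sum => j jD; exact: X1.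
  rewrite -nneseries_sum; last by move=> j i _; rewrite lee_fin; case: ifP.
  apply: (@le_trans _ _ (Lam%:E * hit_cost q z)%E).
    rewrite /hit_cost -nneseriesZl; last first.
      by move=> i _; rewrite lee_fin; case: ifP => // _; exact: powR_ge0.
    apply: lee_nneseries => i _.
      by move=> _; apply: sume_ge0 => j _; rewrite lee_fin; case: ifP.
    rewrite sumEFin -EFinM lee_fin; case: ifP => hi; last first.
      rewrite mulr0 big1// => j jD; case: ifP => // hj.
      by rewrite (hit_parent j) in hi.
    apply: le_trans (count i hi).
    rewrite -big_mkcondr/= sumr_const mulr_natl.
    rewrite [X in _ *+ X <= _](_ : _ = #|[set j in D | hit q' (child j) i]%SET|)//.
    by apply: eq_card => j; rewrite inE.
  by rewrite EFinM lee_wpmul2l ?lee_fin// ltW.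
by rewrite lee_fin leNgt LamD.
Qed.

End step.

(** The unit cube is cheap, so the step can be iterated; the nested cells shrink to a point. *)
Lemma cantor_point :
  (\sum_(0 <= i <oo) (u i `^ t)%:E < cost_const%:E)%E ->
  exists y, [/\ torus R d y,
    forall n0, exists2 n, (n0 <= n)%N & eucl_dist y (p n) < delta n &
    forall i, ~ U i (orth_proj V y)].
Proof.
(* A state consists of the inverse side [q], the cell, and the index of the last center. *)
move=> sum_u; pose st : Type := (nat * ('I_d -> nat) * nat)%type.
pose valid (s : st) := [/\ (0 < s.1.1)%N, forall i, (s.1.2 i < s.1.1)%N & cheap s.1.1 s.1.2].
pose lo (s : st) i : R := (s.1.2 i)%:R / s.1.1%:R.
pose hi (s : st) i : R := ((s.1.2 i)%:R + 1) / s.1.1%:R.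
pose next (s s' : st) := [/\ valid s', (s.2 < s'.2)%N /\ (s.1.1 < s'.1.1)%N,
  forall y, in_cell s'.1.1 s'.1.2 y -> eucl_dist y (p s'.2) < delta s'.2 &
  forall i, lo s i <= lo s' i /\ hi s' i < hi s i].
have /choice[F FP] : forall s, exists s', valid s -> next s s'.
  move=> s; have [[q0 zq zc]|nv] := pselect (valid s); last by exists s.
  have [n [q' [z' [n0 q3 z'q' c' [dist nest]]]]] := cantor_step _ s.2.+1 _ q0 zq zc.
  exists (q', z', n) => _; split => //=.
    by split => //=; rewrite (leq_trans _ q3)// muln_gt0.
  by split => //; rewrite (leq_trans _ q3)// ltn_Pmull.
pose S j := iter j F (1%N, fun=> 0%N, 0%N).
have validS j : valid (S j).
  elim: j => [|j IH]; last by have [] := FP _ IH.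
  split => //=; rewrite /cheap /S/= powR1 divr1; apply: le_lt_trans sum_u.
  apply: lee_nneseries => i _; first by move=> _; rewrite lee_fin; case: ifP => // _; exact: powR_ge0.
  by rewrite lee_fin; case: ifP => // _; exact: powR_ge0.
have nextS j : next (S j) (S j.+1) by exact: FP.
have qS j : (j < (S j).1.1)%N.
  by elim: j => // j IH; have [_ [_ q] _ _] := nextS j; exact: leq_ltn_trans q.
have nS j : (j <= (S j).2)%N.
  by elim: j => // j IH; have [_ [n _] _ _] := nextS j; exact: leq_ltn_trans n.
have q0 j : 0 < (S j).1.1%:R :> R by have [q0 _ _] := validS j; rewrite ltr0n.
have lohi j i : lo (S j) i < hi (S j) i.
  by rewrite /lo /hi ltr_pM2r ?invr_gt0// ltrDl.
have lo_mono i : {homo (fun j => lo (S j) i) : j l / (j <= l)%N >-> j <= l}.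
  apply: homo_leq => // [a|j]; first exact: le_trans.
  by have [_ _ _ /(_ i)[]] := nextS j.
have hi_mono i j l : (j <= l)%N -> hi (S l) i <= hi (S j) i.
  move=> jl; rewrite -(subnK jl); elim: (l - j)%N => [|m IH]; first by rewrite add0n.
  by rewrite addSn; have [_ _ _ /(_ i)[_ /ltW h]] := nextS (m + j)%N; exact: le_trans h IH.
have lo_hi i j l : lo (S j) i <= hi (S l) i.
  apply: (@le_trans _ _ (lo (S (maxn j l)) i)); first by apply: lo_mono; rewrite leq_maxl.
  apply: (le_trans (ltW (lohi _ _))); apply: hi_mono; exact: leq_maxr.
pose y : 'rV[R]_d := \row_i sup (range (fun j => lo (S j) i)).
have supS i : has_sup (range (fun j => lo (S j) i)).
  split; first by exists (lo (S 0) i), 0%N.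
  by exists (hi (S 0) i) => _ [j _ <-].
have y_in j : in_cell (S j).1.1 (S j).1.2 y.
  have [sq _ _] := validS j; apply/in_cellP => // i; rewrite mxE; apply/andP; split.
    by apply: ub_le_sup; [have [] := supS i | exists j].
  (* The upper faces decrease strictly, so the limit stays inside the half-open cells. *)
  have [_ _ _ /(_ i)[_]] := nextS j; apply: le_lt_trans.
  by apply: ge_sup; [have [] := supS i | move=> _ [l _ <-]].
exists y; split.
- by move=> i; have := y_in 0%N i; rewrite /S/= mul1r add0r.
- move=> n0; exists (S n0.+1).2; first by rewrite (leq_trans (nS n0))//; have [_ [/ltnW]] := nextS n0.
  by have [_ _ h _] := nextS n0; apply: h.
(* At this stage the cell has side below [u i], but a cheap cell that is hit by the tube has side
   above [u i]. *)
- move=> i Ui; pose j := Num.truncn (u i)^-1.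
  have [sq _ sc] := validS j.
  have hi_j : hit (S j).1.1 (S j).1.2 i by apply/asboolP; exists y.
  have := lt_hit_inv _ _ _ sq sc hi_j.
  rewrite -[ltLHS]invrK ltf_pV2 ?posrE ?invr_gt0// ltNge => /negP; apply.
  have /truncn_itv/andP[_ h] : 0 <= (u i)^-1 by rewrite invr_ge0 ltW.
  by rewrite (le_trans (ltW h))// ler_nat qS.
Qed.

End cantor_construction.

(** * Hausdorff dimension of the projections *)

Section torus_metric.
Context (R : realType) (d : nat).
Implicit Types (x y a b v : 'rV[R]_d).

Let has_lb x y : has_lbound [set eucl_norm (x - y + map_mx intr z) | z in [set: 'rV[int]_d]].
Proof. by exists 0 => _ [z _ <-]; exact: eucl_norm_ge0. Qed.

Let nonempty x y : [set eucl_norm (x - y + map_mx intr z) | z in [set: 'rV[int]_d]] !=set0.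
Proof. by exists (eucl_norm (x - y + map_mx intr (0 : 'rV[int]_d))), 0. Qed.

Lemma torus_dist_le x y (z : 'rV[int]_d) : torus_dist x y <= eucl_norm (x - y + map_mx intr z).
Proof. by apply: ge_inf => //; exists z. Qed.

Lemma torus_dist_shift x y a b (z : 'rV[int]_d) : x - y = a - b + map_mx intr z ->
  torus_dist x y <= torus_dist a b.
Proof.
move=> e; apply: lb_le_inf => // _ [z' _ <-].
rewrite (_ : a - b + _ = x - y + map_mx intr (z' - z)); first exact: torus_dist_le.
by rewrite e map_mxB -[RHS]addrA [map_mx _ z + _]addrC subrK.
Qed.

Lemma torus_reprE v : torus_repr v = v - map_mx intr (\row_i Num.floor (v 0 i)).
Proof. by apply/rowP => i; rewrite !mxE. Qed.

Lemma torus_repr_id v : torus R d v -> torus_repr v = v.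
Proof.
by move=> tv; apply/rowP => i; rewrite mxE (floor_def (m := 0)) ?subr0.
Qed.

Lemma torus_repr_int v (z : 'rV[int]_d) : torus_repr (v + map_mx intr z) = torus_repr v.
Proof.
apply/rowP => i; rewrite !mxE.
rewrite (floor_def (m := Num.floor (v 0 i) + z 0 i)).
  by rewrite intrD opprD addrACA subrr addr0.
have /andP[h1 h2] := floor_itv (v 0 i); rewrite intrD lerD2r h1/=.
by rewrite addrAC intrD ltrD2r.
Qed.

(** The point of [A] to translate is [y - xi] reduced modulo 1: torus distance is invariant under
    integer shifts and bounded by Euclidean distance. *)
Lemma torus_repr_subset_ball (xi x y : 'rV[R]_d) (delta : R) (A : set 'rV[R]_d) :
  torus_ball x delta `<=` A -> torus R d y ->
  eucl_dist y (torus_repr (xi + x)) < delta -> translate xi A y.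
Proof.
move=> xA ty yc; exists (torus_repr (y - xi)).
  apply: xA; split; first exact: torus_torus_repr.
  apply: le_lt_trans yc.
  set z1 := \row_i Num.floor ((y - xi) 0 i); set z2 := \row_i Num.floor ((xi + x) 0 i).
  have -> : eucl_dist y (torus_repr (xi + x)) = eucl_norm (torus_repr (xi + x) - y).
    apply/eqP; rewrite eq_le; apply/andP; split; apply: eucl_norm_le_coord => i.
      by rewrite !mxE distrC.
    by rewrite !mxE distrC.
  rewrite (_ : torus_repr (xi + x) - y = x - torus_repr (y - xi) + map_mx intr (- z1 - z2)).
    exact: torus_dist_le.
  rewrite !torus_reprE -/z1 -/z2 map_mxB map_mxN; apply/rowP => i; rewrite !mxE; ring.
rewrite [torus_repr (y - xi)]torus_reprE addrA [xi + _]addrC subrK -map_mxN torus_repr_int.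
exact: torus_repr_id.
Qed.

Lemma torus_dist_translate xi a b :
  torus_dist (torus_repr (xi + a)) (torus_repr (xi + b)) <= torus_dist a b.
Proof.
rewrite !torus_reprE; set z1 := \row_i _; set z2 := \row_i _.
apply: (torus_dist_shift _ _ _ _ (z2 - z1)); rewrite map_mxB.
by apply/rowP => i; rewrite !mxE; ring.
Qed.

(** Within a half-cube, coordinates differ by at most one half, so no nonzero integer shift makes a
    difference smaller. *)
Lemma eucl_dist_le_torus_dist x y : torus R d x -> torus R d y ->
  (forall i, (2^-1 <= x 0 i) = (2^-1 <= y 0 i)) -> eucl_dist x y <= torus_dist x y.
Proof.
move=> tx ty xy; apply: lb_le_inf => // _ [z _ <-].
apply: eucl_norm_le_coord => i; rewrite !mxE.
have /andP[x0 x1] := tx i; have /andP[y0 y1] := ty i.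
have h : `|x 0 i - y 0 i| <= 2^-1.
  have := xy i; rewrite ler_norml; case: leP => hx; case: leP => // hy _; apply/andP; split; lra.
have [->|z0] := eqVneq (z 0 i) 0; first by rewrite mulr0z addr0.
have z1 : 1 <= `|(z 0 i)%:~R : R| by rewrite -intr_norm ler1z; lia.
have := lerB_normD ((z 0 i)%:~R) (x 0 i - y 0 i); rewrite [_ + (x 0 i - _)]addrC; lra.
Qed.

(** The torus is bounded, so the extended diameter is finite and [fine] keeps its value. *)
Lemma torus_diam_ge (A : set 'rV[R]_d) a b : A `<=` torus R d -> A a -> A b ->
  torus_dist a b <= torus_diam A.
Proof.
move=> At Aa Ab; pose S := [set (torus_dist q.1 q.2)%:E | q in A `*` A].
have ub : ubound S (d%:R)%:E.
  move=> _ [[x y] [/= /At tx /At ty] <-]; rewrite lee_fin.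
  apply: le_trans (torus_dist_le _ _ 0) _.
  rewrite -[leRHS]mulr1; apply: eucl_norm_le_sup => // i; rewrite !mxE mulr0z addr0.
  have /andP[? ?] := tx i; have /andP[? ?] := ty i.
  by rewrite ler_norml; apply/andP; split; lra.
have Sab : ((torus_dist a b)%:E <= diam (@torus_dist R d) A)%E.
  by apply: ereal_sup_ubound; exists (a, b).
have Sd : (diam (@torus_dist R d) A <= d%:R%:E)%E by exact: ge_ereal_sup.
rewrite -lee_fin /torus_diam fineK// fin_numElt (lt_le_trans _ Sab) ?ltNyr//.
by rewrite (le_lt_trans Sd) ?ltry.
Qed.

End torus_metric.

Lemma diam_ge0 (R : realType) (T : Type) (dist : T -> T -> R) (A : set T) :
  (forall x y, 0 <= dist x y) -> A !=set0 -> (0 <= diam dist A)%E.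
Proof.
move=> d0 [x Ax]; apply: le_trans (ereal_sup_ubound _); last by exists (x, x).
by rewrite lee_fin.
Qed.

Lemma hausdorff_term_ge0 (R : realType) (T : Type) (dist : T -> T -> R) s (A : set T) :
  (0 <= hausdorff_term dist s A)%E.
Proof. by rewrite /hausdorff_term; case: ifP => // _; exact: poweR_ge0. Qed.

(** * Lower bound from good blocks *)

Section lower_bound.
Context (R : realType) (d k : nat) (t K : R).
Context (g : nat -> set 'rV[R]_d) (x xi : nat -> 'rV[R]_d) (delta : nat -> R).
Hypothesis gx : forall n, torus_ball (x n) (delta n) `<=` g n.
Hypothesis t0 : 0 < t.
Hypothesis tk : t < k%:R.
Hypothesis K0 : 0 <= K.
Hypothesis good : forall q n0, (0 < q)%N ->
  good_block (fun n => torus_repr (xi n + x n)) delta k t K q n0.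

Lemma hausdorff_measure_covering_neq0 (V : 'M[R]_d) (s : R) : \rank V = k -> 0 <= s <= t ->
  hausdorff_measure (@eucl_dist R d) s (orth_proj V @` covering_set xi g) <> 0%E.
Proof.
move=> rV /andP[s0 st] H0.
set A := _ @` _ in H0; pose c : R := cost_const (d := d) (k := k) K.
have c0 : 0 < c by exact: cost_const_gt0.
(* Covering sets of diameter at most 1 allow the exponent [s] to be raised to [t]. *)
have : (hausdorff_premeasure (@eucl_dist R d) s 1 A < (c / 2)%:E)%E.
  apply: (@le_lt_trans _ _ 0%E); last by rewrite lte_fin divr_gt0.
  by rewrite -H0; apply: ereal_sup_ubound; exists 1 => //=; exact: ltr01.
move=> /ereal_inf_lt[_ [U [AU diamU] <-] Ulow].
pose D i : R := if U i == set0 then 0 else fine (diam (@eucl_dist R d) (U i)).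
have dist0 (a b : 'rV[R]_d) : 0 <= eucl_dist a b by exact: eucl_norm_ge0.
have diamE i : U i != set0 -> diam (@eucl_dist R d) (U i) = (D i)%:E.
  move=> Ui; rewrite /D (negPf Ui) fineK// fin_numElt.
  rewrite (lt_le_trans _ (diam_ge0 _ _ _ _ dist0 _)) ?ltNyr//; last exact/set0P.
  by rewrite (le_lt_trans (diamU i)) ?ltry.
have D01 i : 0 <= D i <= 1.
  have [Ui|Ui] := eqVneq (U i) set0; first by rewrite /D Ui eqxx lexx ler01.
  rewrite -!lee_fin -diamE// diamU andbT; apply: diam_ge0 => //; exact/set0P.
have Dt i : ((D i `^ t)%:E <= hausdorff_term (@eucl_dist R d) s (U i))%E.
  rewrite /hausdorff_term; case: ifPn => Ui.
    by rewrite /D Ui powR0 ?(gt_eqF t0).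
  rewrite diamE// poweR_EFin lee_fin; have /andP[D0 D1] := D01 i.
  have [->|Dn0] := eqVneq (D i) 0; first by rewrite powR0 ?(gt_eqF t0) ?powR_ge0.
  by rewrite ger_powR// D1 lt_neqAle eq_sym Dn0 D0.
(* The Cantor construction needs positive widths, while a covering set may be a point or empty; the
   added weights sum to at most [c / 2]. *)
pose e i : R := c / 2 / (2 ^ i.+1)%:R.
have e0 i : 0 < e i by rewrite !divr_gt0// ltr0n expn_gt0.
pose u i := (D i `^ t + e i) `^ t^-1.
have ut i : u i `^ t = D i `^ t + e i.
  by rewrite /u -powRrM mulVf ?gt_eqF// powRr1// addr_ge0 ?powR_ge0// ltW.
have u0 i : 0 < u i by rewrite powR_gt0// ltr_wpDl ?powR_ge0.
have Du i : D i <= u i.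
  rewrite -[leLHS]powRr1; last by have /andP[] := D01 i.
  rewrite -[X in _ `^ X <= _](@divff _ t) ?gt_eqF// powRrM.
  apply: ge0_ler_powR; rewrite ?nnegrE ?invr_ge0 ?addr_ge0 ?powR_ge0 ?(ltW t0) ?(ltW (e0 i))//.
  by rewrite lerDl ltW.
have uU i a b : U i a -> U i b -> eucl_dist a b <= u i.
  move=> Ua Ub; apply: le_trans (Du i); rewrite -lee_fin -diamE; last by apply/set0P; exists a.
  by apply: ereal_sup_ubound; exists (a, b).
have sum_u : (\sum_(0 <= i <oo) (u i `^ t)%:E < c%:E)%E.
  under eq_eseriesr do rewrite ut EFinD.
  apply: le_lt_trans (epsilon_trick _ _ _) _.
  - by move=> i; rewrite lee_fin powR_ge0.
  - by rewrite divr_ge0// ltW.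
  rewrite [X in (_ < X%:E)%E](splitr c) EFinD lte_leD//.
  apply: le_lt_trans Ulow; apply: lee_nneseries => i _; last exact: Dt.
  by move=> _; rewrite lee_fin powR_ge0.
have pT n : torus R d (torus_repr (xi n + x n)) by exact: torus_torus_repr.
have [y [yt yE yU]] := cantor_point t K _ delta V U u pT (ltW t0) tk K0 good rV u0 uU sum_u.
have Ey : covering_set xi g y.
  move=> n0 _; have [n n0n ny] := yE n0; exists n => //.
  exact: torus_repr_subset_ball (gx n) yt ny.
have [i _ Ui] : (\bigcup_i U i) (orth_proj V y) by apply: AU; exists y.
exact: yU Ui.
Qed.

Lemma hausdorff_dim_covering_ge (V : 'M[R]_d) : \rank V = k ->
  (t%:E <= hausdorff_dim (@eucl_dist R d) (orth_proj V @` covering_set xi g))%E.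
Proof.
move=> rV; apply: le_ereal_inf_tmp => _ [s [s0 Hs] <-]; rewrite lee_fin leNgt.
by apply/negP => st; apply: (hausdorff_measure_covering_neq0 V s rV) => //; rewrite s0 ltW.
Qed.

End lower_bound.

(** * Upper bound for every realization *)

Section upper_bound.
Context (R : realType) (d : nat).
Context (g : nat -> set 'rV[R]_d) (xi : nat -> 'rV[R]_d) (s : R).
Let rho n := torus_diam (g n).
Hypothesis gT : forall n, g n `<=` torus R d.
Hypothesis rho0 : rho @ \oo --> 0.
Hypothesis s0 : 0 <= s.
Hypothesis sum_rho : (\sum_(0 <= n <oo) (rho n `^ s)%:E < +oo)%E.

Lemma nneseries_divn_le (f : nat -> R) (L : nat) : (0 < L)%N -> (forall n, 0 <= f n) ->
  (\sum_(0 <= i <oo) (f (i %/ L)%N)%:E <= L%:R%:E * \sum_(0 <= n <oo) (f n)%:E)%E.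
Proof.
move=> L0 f0; apply: lime_le.
  by apply: is_cvg_nneseries => n _ _; rewrite lee_fin.
apply: nearW => M; apply: (@le_trans _ _ (\sum_(0 <= i < M * L) f (i %/ L)%N)%:E).
  rewrite sumEFin lee_fin (@big_cat_nat _ _ _ M 0 (M * L))//=; last by rewrite leq_pmulr.
  by rewrite lerDl sumr_ge0.
have -> : \sum_(0 <= i < M * L) f (i %/ L)%N = L%:R * \sum_(0 <= n < M) f n.
  elim: M => [|M IH]; first by rewrite mul0n !big_geq// mulr0.
  rewrite (@big_cat_nat _ _ _ (M * L) 0 (M.+1 * L))//=; last by rewrite leq_mul2r leqnSn orbT.
  rewrite IH big_nat_recr//= mulrDr; congr (_ + _).
  rewrite -[X in \sum_(X <= _ < _) _]add0n big_addn mulSn addnK.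
  rewrite (eq_big_nat _ _ (F2 := fun=> f M)); last first.
    by move=> i /andP[_ iL]; rewrite divnDr ?dvdn_mull// mulnK// divn_small.
  by rewrite sumr_const_nat subn0 mulr_natl.
rewrite EFinM lee_wpmul2l ?lee_fin// -sumEFin.
by apply: nneseries_lim_ge => i _ _; rewrite lee_fin.
Qed.

Lemma hausdorff_dim_covering_le (V : 'M[R]_d) :
  (hausdorff_dim (@eucl_dist R d) (orth_proj V @` covering_set xi g) <= s%:E)%E.
Proof.
apply: ereal_inf_lbound; exists s => //; split => //.
apply/eqP; rewrite eq_le; apply/andP; split; last first.
  apply: le_trans (ereal_sup_ubound _); last by exists 1 => //=; exact: ltr01.
  apply: le_ereal_inf_tmp => _ [U _ <-]; apply: nneseries_ge0 => i _ _.
  exact: hausdorff_term_ge0.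
apply: ge_ereal_sup => _ [delta /= delta0 <-].
apply/lee_addgt0Pr => e e0; rewrite add0e.
pose T := {ffun 'I_d -> bool}; pose L := #|T|.
have L0 : (0 < L)%N by rewrite /L card_ffun card_bool expn_gt0.
have LR : 0 < L%:R :> R by rewrite ltr0n.
have rp n : (0 <= (rho n `^ s)%:E)%E by rewrite lee_fin powR_ge0.
(* Each translate is cut into [L] pieces, hence the division of [e] by [L]. *)
have [m mtail mrho] : exists2 m, (\sum_(m <= n <oo) (rho n `^ s)%:E <= (e / L%:R)%:E)%E &
    forall n, (m <= n)%N -> rho n <= delta.
  have [m1 _ h1] : \forall n \near \oo, (\sum_(n <= i <oo) (rho i `^ s)%:E < (e / L%:R)%:E)%E.
    have tail0 := nneseries_tail_cvg sum_rho (fun n _ => rp n).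
    have eL : (0 < (e / L%:R)%:E)%E by rewrite lte_fin divr_gt0.
    exact: (tail0 _ (open_ereal_lt' eL)).
  have [m2 _ h2] : \forall n \near \oo, rho n < delta by apply: cvgr_lt rho0 _ delta0.
  exists (maxn m1 m2); first by rewrite ltW// h1//= leq_maxl.
  by move=> n mn; rewrite ltW// h2//= (leq_trans _ mn)// leq_maxr.
pose half (q : T) : set 'rV[R]_d := [set y | forall i, q i = (2^-1 <= y 0 i)].
pose q0 : T := [ffun=> false].
(* Division with remainder by [L] enumerates the pairs of an index from [m] on and a half-cube. *)
pose n_ i := (i %/ L + m)%N; pose q_ i := nth q0 (enum T) (i %% L).
pose U i := orth_proj V @` (translate (xi (n_ i)) (g (n_ i)) `&` half (q_ i)).
have diamU i : (diam (@eucl_dist R d) (U i) <= (rho (n_ i))%:E)%E.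
  apply: ge_ereal_sup => _ [[a b] [/= [x [[x' gx' <-] hx] <-] [y [[y' gy' <-] hy] <-]] <-].
  rewrite lee_fin; apply: le_trans (torus_diam_ge _ _ _ _ _ (gT _) gx' gy').
  apply: le_trans (torus_dist_translate _ _ (xi (n_ i)) _ _).
  rewrite {1}/eucl_dist -orth_projB (le_trans (eucl_norm_orth_proj _ _ _ _))//.
  apply: eucl_dist_le_torus_dist; try exact: torus_torus_repr.
  by move=> l; rewrite -hx -hy.
have dist0 (a b : 'rV[R]_d) : 0 <= eucl_dist a b by exact: eucl_norm_ge0.
apply: (@le_trans _ _ (\sum_(0 <= i <oo) hausdorff_term (@eucl_dist R d) s (U i))%E).
  apply: ereal_inf_lbound; exists U => //; split; last first.
    by move=> i; rewrite (le_trans (diamU i))// lee_fin mrho// leq_addl.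
  move=> _ [y Ey <-]; have [n mn yn] := Ey m I.
  pose q : T := [ffun i => 2^-1 <= y 0 i].
  have qL : (index q (enum T) < L)%N by rewrite /L cardE index_mem mem_enum.
  exists ((n - m) * L + index q (enum T))%N => //; exists y => //; split.
    rewrite /n_ divnMDl// divn_small// addn0 subnK//.
  rewrite /q_ modnMDl modn_small// nth_index ?mem_enum// => i.
  by rewrite ffunE.
apply: (@le_trans _ _ (\sum_(0 <= i <oo) (rho (i %/ L + m) `^ s)%:E)%E).
  apply: lee_nneseries => i _; first by move=> _; exact: hausdorff_term_ge0.
  rewrite /hausdorff_term; case: ifPn => // Ui.
  have D0 : (0 <= diam (@eucl_dist R d) (U i))%E by apply: diam_ge0 => //; exact/set0P.
  rewrite -poweR_EFin gt0_ler_poweR ?in_itv//= ?leey ?andbT//.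
  exact: le_trans D0 (diamU i).
have := nneseries_divn_le (fun n => rho (n + m)%N `^ s) L L0 (fun n => powR_ge0 _ _).
move/le_trans; apply; rewrite (@nneseries_addn R (fun n => (rho n `^ s)%:E))//.
apply: (@le_trans _ _ (L%:R%:E * (e / L%:R)%:E)%E); first by rewrite lee_wpmul2l ?lee_fin.
by rewrite -EFinM mulrCA divff ?mulr1// gt_eqF.
Qed.

End upper_bound.

(** * Equality of the dimensions, almost surely for all planes *)

Theorem theorem6p2 (R : realType) (d k : nat)
    (disp : measure_display) (Omega : measurableType disp)
    (P : probability Omega R)
    (g : nat -> set 'rV[R]_d)
    (xi : nat -> {RV P >-> borel_rV R d}) :
  (3 <= d)%N -> (1 <= k <= d)%N ->
  ball_like g ->
  (forall n, uniform_on_torus (xi n)) ->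
  mutually_independent xi ->
  (covering_dim g < k%:R%:E)%E ->
  {ae P, forall w, forall V : 'M[R]_d, \rank V = k ->
    hausdorff_dim (@eucl_dist R d)
      (orth_proj V @` covering_set (fun n => xi n w) g) = covering_dim g}.
Proof.
move=> d3 _ [gT rho_dec rho0 [x [delta [xdelta ratio]]]] xi_unif xi_indep dimk.
have d0 : (0 < d)%N by exact: leq_trans d3.
have xT n : torus R d (x n) by have [] := xdelta n.
have delta0 n : 0 < delta n by have [] := xdelta n.
have gx n : torus_ball (x n) (delta n) `<=` g n by have [] := xdelta n.
have dim0 : (0 <= covering_dim g)%E.
  by apply: le_ereal_inf_tmp => _ [s [s0 _] <-]; rewrite lee_fin.
have dimE : covering_dim g = (fine (covering_dim g))%:E.
  by rewrite fineK// fin_numElt (lt_le_trans _ dim0) ?ltNyr// (lt_trans dimk) ?ltry.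
set s0 := fine (covering_dim g) in dimE.
have s00 : 0 <= s0 by rewrite -lee_fin -dimE.
have s0k : s0 < k%:R by rewrite -lte_fin -dimE.
have dvg s : 0 <= s < s0 -> ~ (\sum_(0 <= n <oo) (torus_diam (g n) `^ s)%:E < +oo)%E.
  move=> /andP[sp ss0] h; have : (covering_dim g <= s%:E)%E.
    by apply: ereal_inf_lbound; exists s.
  by rewrite dimE lee_fin leNgt ss0.
(* Countably many exponents increasing to [s0] keep the exceptional set null; [n.+2] makes them
   positive. *)
pose t n : R := s0 - s0 / n.+2%:R.
have tP n : 0 < s0 -> 0 < t n < s0.
  move=> sp; have n2 : 0 < n.+2%:R :> R by rewrite ltr0n.
  rewrite subr_gt0 ltr_pdivrMr// ltr_pMr// ltr1n/=.
  by rewrite ltrBlDr ltrDl divr_gt0.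
have ae_good n : {ae P, forall w, 0 < s0 -> forall q n0, (0 < q)%N ->
    good_block (fun m => translate_center xi x m w) delta k (t n) (crowding_const R d) q n0}.
  have [sp|sp] := ltP 0 s0; last by exact: aeW.
  have /andP[t0 ts] := tP n sp; pose s1 := (t n + s0) / 2.
  have ts1 : t n < s1 by rewrite /s1; lra.
  have s1s : 0 <= s1 < s0 by rewrite /s1; apply/andP; split; lra.
  have tk : t n < k%:R by exact: lt_trans s0k.
  have := ae_good_block _ _ _ P d xi x xi_unif xi_indep xT _ delta k (t n) s1 d0
    rho_dec rho0 ratio delta0 (dvg _ s1s) (ltW t0) ts1 tk.
  by apply: negligibleS => w /= h good; apply: h => _.
have := negligible_bigcup ae_good; apply: negligibleS => w /= wbad.
apply: contrapT => wgood; apply: wbad => V rV.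
have K0 : 0 <= crowding_const R d by rewrite mulr_ge0// exprn_ge0.
apply/eqP; rewrite eq_le; apply/andP; split.
  apply: le_ereal_inf_tmp => _ [s [sp sum_s] <-].
  exact: hausdorff_dim_covering_le.
(* For [s0 = 0] the lower bound is the nonnegativity of the dimension. *)
have [sp|sp] := ltP 0 s0; last first.
  rewrite dimE (le_trans (_ : _ <= 0)%E) ?lee_fin//.
  by apply: le_ereal_inf_tmp => _ [s [? _] <-]; rewrite lee_fin.
have lower n : ((t n)%:E <= hausdorff_dim (@eucl_dist R d)
    (orth_proj V @` covering_set (fun n => xi n w) g))%E.
  have /andP[t0 ts] := tP n sp.
  apply: (hausdorff_dim_covering_ge _ d k (t n) (crowding_const R d) g x _ delta) => //.
    exact: lt_trans s0k.
  move=> q n0 q0; apply: contrapT => bad; apply: wgood; exists n => //= h.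
  by apply: bad; exact: h.
rewrite dimE; apply/lee_addgt0Pr => e e0.
pose n := Num.truncn (s0 / e).
apply: le_trans (leeD2r _ (lower n)); rewrite -EFinD lee_fin /t.
rewrite -addrA lerDl addrC subr_ge0.
rewrite ler_pdivrMr ?ltr0n// mulrC -ler_pdivrMr//.
have /truncn_itv/andP[_ h] : 0 <= s0 / e by rewrite divr_ge0// ltW.
by rewrite (le_trans (ltW h))// ler_nat.
Qed.
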